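(* Let $u_0:\mathbb R^d\to\mathbb R$ be nondecreasing (in the coordinatewise order) and locally Lipschitz, satisfying for every $b\in\mathbb R^d$ $$\lim_{M\to\infty}\sup\{|y|_\infty^{-d/(d+1)}u_0(y): y\le b,\ |y|_\infty\ge M\}=-\infty.$$ Suppose that on some probability space there are random initial height functions $\sigma_n(\cdot,0)$, $n\ge1$, each a.s. in $\Sigma$, such that (12) for every $y\in\mathbb R^d$, $n^{-1}\sigma_n(ny,0)\to u_0(y)$ a.s.; and (13) for every fixed $b\in\mathbb R^d$ and $C>0$, with probability one there exist finite (possibly random) $M,N>0$ such that $n\ge N$, $y\le b$, $|y|_\infty\ge M$ imply $\sigma_n(ny,0)\le -Cn|y|_\infty^{d/(d+1)}$. Augment the probability space with a rate-one Poisson point process on $\mathbb R^d\times(0,\infty)$ and define $\sigma_n(x,t)=\sup_{y\le x}\{\sigma_n(y,0)+\mathbf H((y,0),(x,t))\}$ for $t>0$ (the same Poisson process for all $n$). Define $u(x,0)=u_0(x)$ and, for $t>0$, $$u(x,t)=\sup_{y\le x}\{u_0(y)+t\,g((x-y)/t)\}.$$ Then for every $(x,t)\in\mathbb R^d\times[0,\infty)$, $\lim_{n\to\infty}n^{-1}\sigma_n(nx,nt)=u(x,t)$ almost surely.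
   Context: Order conventions: for $x,y\in\mathbb R^\nu$ write $x\le y$ if $x_i\le y_i$ for all $i$, and $x<y$ if $x_i<y_i$ for all $i$; rectangles are $(a,b]=\{x:a<x\le b\}$, etc.; $\mathbf 1=(1,\dots,1)$; $|x|_\infty=\max_i|x_i|$. Fix $d\ge2$. $\mathbb Z^*=\mathbb Z\cup\{\pm\infty\}$. The state space $\Sigma$ is the set of functions $\sigma:\mathbb R^d\to\mathbb Z^*$ such that (i) $x\le y$ implies $\sigma(x)\le\sigma(y)$; (ii) for every cube $[-q\mathbf 1,q\mathbf 1]$ there are finite partitions $-q=s_i^0<\dots<s_i^{m_i}=q$ of each coordinate axis such that $\sigma$ is constant on each rectangle $\prod_{i}[s_i^{k_i},s_i^{k_i+1})$; (iii) for every $b\in\mathbb R^d$, $\lim_{M\to\infty}\sup\{|y|_\infty^{-d/(d+1)}\sigma(y): y\le b,\ |y|_\infty\ge M\}=-\infty$. For $y\le x$ in $\mathbb R^d$ and $t>0$, $\mathbf H((y,0),(x,t))$ is the maximal $m\ge0$ such that there are Poisson points $p^1<\dots<p^m$ (strict coordinatewise order in $\mathbb R^{d+1}$) in $\{(\eta,s):y<\eta\le x,\ 0<s\le t\}$. $c_{d+1}$ denotes the constant such that, for a rate-one Poisson point process on $\mathbb R^{d+1}$, the maximal number of Poisson points on a strictly increasing chain in $(0,n\mathbf 1]$ divided by $n$ converges a.s. to $c_{d+1}$. For $x\in[0,\infty)^d$, $g(x)=c_{d+1}(x_1x_2\cdots x_d)^{1/(d+1)}$, and $g=-\infty$ outside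 $[0,\infty)^d$. *)

(* Defs.v *)
From HB Require Import structures.
From mathcomp Require Import all_boot all_order all_algebra.
From mathcomp Require Import all_classical all_reals all_analysis.
Set Implicit Arguments. Unset Strict Implicit. Unset Printing Implicit Defensive.
Import Order.TTheory GRing.Theory Num.Theory.
Local Open Scope classical_set_scope.
Local Open Scope ring_scope.

Section Defs.
Variables (R : realType) (d : nat).

Definition pt := 'I_d -> R.
Definition spt := (pt * R)%type.

Definition ptle (x y : pt) : Prop := forall i, x i <= y i.
Definition ptlt (x y : pt) : Prop := forall i, x i < y i.
Definition ptsub (x y : pt) : pt := fun i => x i - y i.
Definition ptscale (a : R) (x : pt) : pt := fun i => a * x i.
Definition ptone : pt := fun _ => 1.
Definition ptzero : pt := fun _ => 0.

Definition normi (x : pt) : R := \big[Num.max/0]_(i < d) `|x i|.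

Definition sptlt (p q : spt) : Prop := ptlt p.1 q.1 /\ p.2 < q.2.

Definition Hcount (pts : set spt) (y x : pt) (t : R) : \bar R :=
  ereal_sup [set ((m%:R)%:E : \bar R) | m in
    [set m : nat | exists p : 'I_m -> spt,
       (forall i, pts (p i) /\ ptlt y (p i).1 /\ ptle (p i).1 x
                  /\ 0 < (p i).2 /\ (p i).2 <= t) /\
       (forall i j : 'I_m, (i < j)%N -> sptlt (p i) (p j))]].

Definition srect (a b : pt) (s1 s2 : R) : set spt :=
  [set p | ptlt a p.1 /\ ptle p.1 b /\ s1 < p.2 /\ p.2 <= s2].
Definition svol (a b : pt) (s1 s2 : R) : R :=
  (\prod_(i < d) (b i - a i)) * (s2 - s1).

(* rate-one Poisson point process on R^d x (0,oo), given as a random set of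
   points: for every finite family of pairwise disjoint bounded rectangles
   inside R^d x (0,oo), the numbers of points are independent Poisson
   variables with means the volumes. *)
Definition poisson_pp (dT : measure_display) (T : measurableType dT)
    (P : probability T R) (pts : T -> set spt) : Prop :=
  (forall w, pts w `<=` [set p | 0 < p.2]) /\
  forall (m : nat) (a b : 'I_m -> pt) (s1 s2 : 'I_m -> R) (k : 'I_m -> nat),
    (forall i, ptlt (a i) (b i) /\ 0 <= s1 i /\ s1 i < s2 i) ->
    (forall i j, i != j -> srect (a i) (b i) (s1 i) (s2 i) `&`
                           srect (a j) (b j) (s1 j) (s2 j) = set0) ->
    let E := [set w | forall i,
                ((pts w `&` srect (a i) (b i) (s1 i) (s2 i)) #= `I_(k i))%card] in
    measurable E /\
    P E = (\prod_(i < m)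
             (expR (- svol (a i) (b i) (s1 i) (s2 i))
              * svol (a i) (b i) (s1 i) (s2 i) ^+ k i / (k i)`!%:R))%:E.

Definition dexp : R := d%:R / d.+1%:R.

Definition in_Sigma (s : pt -> \bar R) : Prop :=
  (forall x, s x = -oo%E \/ s x = +oo%E \/ exists z : int, s x = (z%:~R)%:E) /\
  (forall x y, ptle x y -> (s x <= s y)%E) /\
  (forall q : R, 0 < q -> exists (m : 'I_d -> nat) (sg : 'I_d -> nat -> R),
     (forall i, sg i 0%N = - q /\ sg i (m i) = q /\
                forall k, (k < m i)%N -> sg i k < sg i k.+1) /\
     forall kk : 'I_d -> nat, (forall i, (kk i < m i)%N) ->
       exists c : \bar R, forall x : pt,
         (forall i, sg i (kk i) <= x i < sg i (kk i).+1) -> s x = c) /\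
  (forall b : pt,
     (fun M : R => ereal_sup [set ((normi y `^ (- dexp))%:E * s y)%E
                              | y in [set y | ptle y b /\ M <= normi y]])
       @ +oo --> -oo%E).

Definition gfun (c : R) (z : pt) : \bar R :=
  if [forall i, 0 <= z i] then (c * (\prod_(i < d) z i) `^ (d.+1%:R)^-1)%:E
  else -oo%E.

Definition nondecr (u0 : pt -> R) : Prop :=
  forall x y, ptle x y -> u0 x <= u0 y.

Definition loc_lipschitz (u0 : pt -> R) : Prop :=
  forall x : pt, exists r L : R, 0 < r /\ forall y z,
    normi (ptsub y x) < r -> normi (ptsub z x) < r ->
    `|u0 y - u0 z| <= L * normi (ptsub y z).

Definition u0_growth (u0 : pt -> R) : Prop :=
  forall b : pt,
    (fun M : R => ereal_sup [set ((normi y `^ (- dexp)) * u0 y)%:E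
                             | y in [set y | ptle y b /\ M <= normi y]])
      @ +oo --> -oo%E.

Definition ufun (c : R) (u0 : pt -> R) (x : pt) (t : R) : \bar R :=
  if t == 0 then (u0 x)%:E
  else ereal_sup [set ((u0 y)%:E + t%:E * gfun c (ptscale t^-1 (ptsub x y)))%E
                  | y in [set y | ptle y x]].

Definition sigmat (s0 : pt -> \bar R) (pts : set spt) (x : pt) (t : R)
  : \bar R :=
  if t == 0 then s0 x
  else ereal_sup [set (s0 y + Hcount pts y x t)%E | y in [set y | ptle y x]].

End Defs.

(* Main.v *)
Require Import Defs.
From HB Require Import structures.
From mathcomp Require Import all_boot all_order all_algebra.
From mathcomp Require Import all_classical all_reals all_analysis.
Import Order.TTheory GRing.Theory Num.Theory.
Local Open Scope classical_set_scope.
Local Open Scope ring_scope.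
From mathcomp Require Import ring lra zify.
Import numFieldNormedType.Exports.

Set Implicit Arguments. Unset Strict Implicit. Unset Printing Implicit Defensive.

(** Chains of Poisson points are observed on a dyadic grid: a chain exists iff
    some fine enough grid has an increasing sequence of occupied cells. Hence
    the law of the longest chain in a box depends only on the volume of the box,
    disjoint boxes are independent, and a union bound gives
    P(chain of length m) <= V^m / (m!)^(d+1).

    The hypothesis on [c] only concerns cubes with a corner at the origin,
    whereas the boxes (ny, nx] x (0, nt] move with n. For the upper bound, the
    boxes between consecutive points r^k on the diagonal are disjoint and, by
    superadditivity, almost surely have chains of length at most
    (c + e)(r - 1)r^k eventually; by the second Borel-Cantelli lemma the
    probabilities of the exceptional events are summable, and these probabilities
    are the same for any boxes of the same volumes. The first Borel-Cantelli
    lemma and monotonicity in n then treat the moving boxes. For the lower bound,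
    a box is cut along its diagonal into many independent blocks of a fixed
    large volume, most of which are good with exponentially high probability.

    Base points y far away are discarded by comparing (13) with the bound
    H((ny,0),(nx,nt)) <= C n |y|^(d/(d+1)), which follows from the union bound;
    the remaining ones range over a compact set, on which the supremum is
    controlled by monotonicity and rational points bracketing y. *)

(** * Finite unions, intersections and sums of events *)

Section FiniteFamilies.
Context (dT : measure_display) (T : measurableType dT) (R : realType).
Variable P : probability T R.

Lemma measurable_all_fin (I : finType) (Q : pred I) (A : I -> set T) :
  (forall i, Q i -> measurable (A i)) ->
  measurable [set w | forall i, Q i -> A i w].
Proof.
move=> mA; rewrite (_ : mkset _ = \bigcap_(i in [set i | Q i]) A i) //.
exact: fin_bigcap_measurable.
Qed.

Lemma measurable_ex_fin (I : finType) (Q : pred I) (A : I -> set T) :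
  (forall i, Q i -> measurable (A i)) ->
  measurable [set w | exists2 i, Q i & A i w].
Proof.
move=> mA; rewrite (_ : mkset _ = \bigcup_(i in [set i | Q i]) A i) //.
exact: fin_bigcup_measurable.
Qed.

Lemma union_bound_fin (I : finType) (Q : pred I) (A : I -> set T) :
  (forall i, Q i -> measurable (A i)) ->
  (P [set w | exists2 i, Q i & A i w] <= \sum_(i | Q i) P (A i))%E.
Proof.
move=> mA.
have -> : [set w | exists2 i, Q i & A i w] = \big[setU/set0]_(i | Q i) A i.

  apply/seteqP; split => w /=.
    by move=> [i Qi Aiw]; rewrite (bigD1 i) //=; left.
  by elim/big_ind : _ => //[x y ihx ihy [/ihx|/ihy]//|i Qi Aiw]; exists i.
suff [] : measurable (\big[setU/set0]_(i | Q i) A i) /\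
  (P (\big[setU/set0]_(i | Q i) A i) <= \sum_(i | Q i) P (A i))%E by [].
elim/big_rec2 : _ => [|i x y Qi [my ihy]]; first by rewrite measure0.
split; first by apply: measurableU => //; exact: mA.
by apply: (le_trans (measureU2 _ _ _)) => //; [exact: mA|rewrite leeD2l].
Qed.

Lemma sum_over_values (K : finType) (f : T -> K) (Q : pred K) :
  (forall k, measurable [set w | f w = k]) ->
  measurable [set w | Q (f w)] /\
  P [set w | Q (f w)] = (\sum_(k | Q k) P [set w | f w = k])%E.
Proof.
move=> mf; rewrite -big_filter.
have -> : [set w | Q (f w)] = [set w | f w \in [seq k <- index_enum K | Q k]].
  by apply/seteqP; split => w /=; rewrite mem_filter mem_index_enum andbT.
have : uniq [seq k <- index_enum K | Q k] by rewrite filter_uniq ?index_enum_uniq.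
elim: [seq k <- index_enum K | Q k] => [_|k s ih /= /andP[ks /ih [ms es]]].
  have -> : [set w | f w \in [::]] = set0 by apply/seteqP; split.
  by rewrite big_nil measure0.
rewrite (_ : [set w | f w \in k :: s] = [set w | f w = k] `|` [set w | f w \in s]).
  split; first exact: measurableU.
  rewrite big_cons.
  transitivity (P [set w | f w = k] + P [set w | f w \in s])%E;
    last by congr (_ + _)%E.
  apply: measureU => //.
  by apply/seteqP; split => w //= -[->]; rewrite (negPf ks).
apply/seteqP; split => w /=; rewrite inE; first by case/orP => [/eqP|]; [left|right].
by case=> [->|->]; rewrite ?eqxx ?orbT.
Qed.

End FiniteFamilies.

(** * Laws of occupancy patterns of finitely many cells, computed from void probabilities *)

Section VoidPatterns.
Context (dT : measure_display) (T : measurableType dT) (R : realType).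
Variables (P : probability T R) (J : finType) (V : J -> set T) (q : J -> R).
Hypothesis mV : forall j, measurable (V j).
Hypothesis PV : forall S : {set J},
  P [set w | forall j, j \in S -> V j w] = (\prod_(j in S) q j)%:E.

Definition split_event (S A : {set J}) : set T :=
  [set w | (forall j, j \in S -> V j w) /\ (forall j, j \in A -> ~ V j w)].

Lemma measurable_split_event (S A : {set J}) : measurable (split_event S A).
Proof.
apply: measurableI; apply: measurable_all_fin => j _ //.
exact: measurableC.
Qed.

(** Inclusion-exclusion one index at a time: splitting [split_event S (A :\ j)] according to [V j]
    writes the event with [j] in [A] as a difference of two events with a smaller second set, and
    the factor [1 - q j] comes out. *)
Lemma prob_split_event (S A : {set J}) : (forall j, j \in S -> j \notin A) ->
  P (split_event S A) = ((\prod_(j in S) q j) * (\prod_(j in A) (1 - q j)))%:E.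
Proof.
elim: {A}_.+1 {-2}A S (ltnSn #|A|) => // n ih A S.
have [->|/set0Pn[j jA]] := eqVneq A finset.set0.
  move=> _ _; rewrite big_set0 mulr1 -PV; congr (P _).
  by apply/seteqP; split => w /=; [case|split=> // k; rewrite inE].
rewrite (cardsD1 j) jA add1n ltnS => An dSA.
have jS : j \notin S by apply/negP => /dSA; rewrite jA.
have dSA' k : k \in S -> k \notin (A :\ j)%SET.
  by move=> /dSA kA; rewrite !inE (negPf kA) andbF.
have dSjA' k : k \in (j |: S)%SET -> k \notin (A :\ j)%SET.
  by rewrite inE => /orP[/set1P->|/dSA'//]; rewrite !inE eqxx.
have e1 : split_event S (A :\ j)%SET `\` V j = split_event S A.
  apply/seteqP; split => w /=; rewrite /split_event/=.
    move=> [[hS hA] nj]; split => // k kA; have [->//|kj] := eqVneq k j.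
    by apply: hA; rewrite !inE kj.
  by move=> [hS hA]; split; [split=> // k; rewrite !inE => /andP[_]; exact: hA|exact: hA].
have e2 : split_event S (A :\ j)%SET `&` V j =
          split_event (j |: S)%SET (A :\ j)%SET.
  apply/seteqP; split => w /=; rewrite /split_event/=.
    move=> [[hS hA] hj]; split => // k; rewrite !inE => /orP[/eqP->//|].
    exact: hS.
  move=> [hS hA]; split; last by apply: hS; rewrite !inE eqxx.
  by split=> // k kS; apply: hS; rewrite !inE kS orbT.
have eP : P (split_event S (A :\ j)%SET) =
    (P (split_event S A) + P (split_event (j |: S)%SET (A :\ j)%SET))%E.
  by rewrite -e1 -e2; exact: measureDI (measurable_split_event _ _) (mV j).
move: eP; rewrite (ih (A :\ j)%SET S)// (ih (A :\ j)%SET (j |: S)%SET)//.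
rewrite big_setU1//= (big_setD1 j jA)/= => eP.
have Pfin : P (split_event S A) \is a fin_num.
  exact/fin_num_measure/measurable_split_event.
rewrite -(fineK Pfin) in eP *; congr EFin.
by move: eP => [eP]; lra.
Qed.

Definition void_pattern (w : T) : {set J} := [set j | `[< V j w >]]%SET.

Lemma void_pattern_eqP w (S : {set J}) : void_pattern w = S <-> split_event S (~: S)%SET w.
Proof.
split=> [<-|[h1 h2]].
  by split=> j; rewrite !finset.inE; [move/asboolP|move/asboolPn].
apply/setP => j; rewrite inE; apply/asboolP/idP; last exact: h1.
by apply: contraPT => jS; apply: h2; rewrite inE.
Qed.

(** A pattern is a split event in which every index is decided, so the void probabilities determine
    the whole law of the pattern. *)
Lemma prob_void_pattern (S : {set J}) :
  measurable [set w | void_pattern w = S] /\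
  P [set w | void_pattern w = S] =
  (\prod_j (if j \in S then q j else 1 - q j))%:E.
Proof.
rewrite (_ : mkset _ = split_event S (~: S)%SET); last first.
  by apply/seteqP; split=> w /void_pattern_eqP.
split; first exact: measurable_split_event.
rewrite prob_split_event; last by move=> j jS; rewrite inE jS.
rewrite [in RHS](bigID (mem S))/=; congr (_ * _)%:E.
  by apply: eq_bigr => j ->.
by apply: eq_big => [j|j]; rewrite ?inE// => /negPf->.
Qed.

End VoidPatterns.

(** The patterns of all blocks together form one void pattern indexed by [I * C], whose probability
    is a product over the blocks. Summing over [family Q] and exchanging product and sum gives the
    independence of the blocks. *)
Lemma prob_block_statistics (dT : measure_display) (T : measurableType dT)
  (R : realType) (P : probability T R) (I C : finType) (V : I -> C -> set T)
  (q : I -> R) (Q : I -> pred {set C}) :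
  (forall i v, measurable (V i v)) ->
  (forall S : {set I * C},
     P [set w | forall j, j \in S -> V j.1 j.2 w] = (\prod_(j in S) q j.1)%:E) ->
  measurable [set w | forall i, Q i (void_pattern (V i) w)] /\
  P [set w | forall i, Q i (void_pattern (V i) w)] =
  (\prod_i \sum_(S | Q i S) \prod_v (if v \in S then q i else 1 - q i))%:E.
Proof.
move=> mV PV; set W := fun j : I * C => V j.1 j.2.
pose f w : {ffun I -> {set C}} := [ffun i => void_pattern (V i) w].
have fE w (F : {ffun I -> {set C}}) : f w = F <->
    void_pattern W w = [set j | j.2 \in F j.1]%SET.
  split=> [<-|h].
    by apply/setP => -[i v]; rewrite !inE ffunE inE.
  apply/ffunP => i; apply/setP => v; rewrite ffunE inE.
  by move/setP/(_ (i, v)): h; rewrite !inE.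
have mW j : measurable (W j) by exact: mV.
have Pf F : measurable [set w | f w = F] /\ P [set w | f w = F] =
    (\prod_i \prod_v (if v \in F i then q i else 1 - q i))%:E.
  rewrite (_ : mkset _ = [set w | void_pattern W w = [set j | j.2 \in F j.1]%SET]);
    last by apply/seteqP; split=> w /fE.
  have [? ->] := prob_void_pattern mW PV [set j | j.2 \in F j.1]%SET.
  split=> //; rewrite pair_big/=; congr EFin; apply: eq_bigr => -[i v] _.
  by rewrite inE.
have [mQ PQ] := sum_over_values P (fun F => F \in family Q) (fun F => (Pf F).1).
have eQ : [set w | forall i, Q i (void_pattern (V i) w)] =
    [set w | f w \in family Q].
  apply/seteqP; split => w /= => [h|/familyP h].
    by apply/familyP => i; rewrite ffunE; exact: h.
  by move=> i; have := h i; rewrite ffunE.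
rewrite eQ; split=> //; rewrite PQ bigA_distr_big_dep -sumEFin.
by apply: eq_bigr => F _; rewrite (Pf F).2.
Qed.

(** * Almost sure events and the two Borel-Cantelli lemmas *)

Lemma ae_and (dT : measure_display) (T : measurableType dT) (R : realType)
  (mu : {measure set T -> \bar R}) (A B : T -> Prop) :
  {ae mu, forall w, A w} -> {ae mu, forall w, B w} ->
  {ae mu, forall w, A w /\ B w}.
Proof. by apply: filterS2 => w. Qed.

Lemma ae_forall_countable (dT : measure_display) (T : measurableType dT)
  (R : realType) (mu : {measure set T -> \bar R}) (I : countType)
  (Q : I -> T -> Prop) :
  (forall i, {ae mu, forall w, Q i w}) -> {ae mu, forall w, forall i, Q i w}.
Proof.
move=> hQ.
have : {ae mu, forall w, forall n, if @unpickle I n is Some i then Q i w else True}.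
  by apply/ae_foralln => n; case: unpickle => [i|]; [exact: hQ|exact: aeW].
by apply: filterS => w h i; have := h (pickle i); rewrite pickleK.
Qed.

Section BorelCantelli.
Context (dT : measure_display) (T : measurableType dT) (R : realType).
Variable P : probability T R.

Lemma borel_cantelli (A : nat -> set T) (p : nat -> R) (M : R) :
  (forall n, measurable (A n)) -> (forall n, (P (A n) <= (p n)%:E)%E) ->
  (forall N, \sum_(n < N) p n <= M) ->
  {ae P, forall w, exists N, forall n, (N <= n)%N -> ~ A n w}.
Proof.
move=> mA Ap sM.
have h0 : P (lim_sup_set A) = 0.
  apply: lim_sup_set_cvg0 => //; apply: (@le_lt_trans _ _ M%:E); last exact: ltry.
  apply: lime_le.
    by apply: is_cvg_nneseries => n _ _; exact: measure_ge0.
  near=> N; rewrite big_mkord; apply: (@le_trans _ _ (\sum_(n < N) p n)%:E).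
    by rewrite -sumEFin; apply: lee_sum => n _; exact: Ap.
  by rewrite lee_fin.
exists (lim_sup_set A); split=> //.
  apply: bigcap_measurable => // n _; apply: bigcup_measurable => //.
move=> w /= hw n _; apply: contrapT => h; apply: hw; exists n => k nk Ak.
by apply: h; exists k.
Unshelve. all: by end_near. Qed.

(** The limsup of the events is null, so by continuity from above the tail unions, which contain
    [A n], have probabilities tending to zero. *)
Lemma ae_eventually_not_small (A : nat -> set T) (p : R) : 0 < p ->
  (forall n, measurable (A n)) ->
  {ae P, forall w, exists N, forall n, (N <= n)%N -> ~ A n w} ->
  \forall n \near \oo, (P (A n) <= p%:E)%E.
Proof.
move=> p0 mA [B [mB PB sB]].
have mL : measurable (lim_sup_set A).
  by apply: bigcap_measurable => // n _; apply: bigcup_measurable.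
have h0 : P (lim_sup_set A) = 0.
  apply: (subset_measure0 mL mB _ PB); apply: subset_trans sB => w hw /= [N hN].
  by have [k /= Nk Ak] := hw N I; exact: hN k Nk Ak.
have mU n : measurable (\bigcup_(k in [set k | (n <= k)%N]) A k).
  exact: bigcup_measurable.
have : P (\bigcup_(k in [set k | (n <= k)%N]) A k) @[n --> \oo] --> 0%E.
  rewrite -h0; apply: lim_sup_set_cvg => //.
  by apply: (le_lt_trans (probability_le1 P (mU 0%N))); exact: ltry.
move=> /fine_cvgP[_ /cvgrPdist_le /(_ p p0)].
apply: filterS => n; rewrite sub0r normrN => h.
apply: (@le_trans _ _ (P (\bigcup_(k in [set k | (n <= k)%N]) A k))).
  by apply: le_measure; rewrite ?inE// => w Aw; exists n => //=.
rewrite -[leLHS]fineK ?fin_num_measure// lee_fin.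
exact: le_trans (ler_norm _) h.
Qed.

(** Contrapositive of the second Borel-Cantelli lemma. Some [G K] has positive probability [dl];
    independence and [1 - p <= expR (- p)] bound [dl] by the exponential of minus any partial sum
    starting at [K], so these sums are at most [- ln dl]. *)
Lemma bounded_sum_of_ae_finitely_often (A : nat -> set T) (p : nat -> R) :
  (forall n, measurable (A n)) -> (forall n, P (A n) = (p n)%:E) ->
  (forall K L, P [set w | forall k, (K <= k < L)%N -> ~ A k w] =
               (\prod_(K <= k < L) (1 - p k))%:E) ->
  {ae P, forall w, exists N, forall n, (N <= n)%N -> ~ A n w} ->
  exists M, forall N, \sum_(n < N) p n <= M.
Proof.
move=> mA Ap indA aeA.
pose G K := \bigcap_(k in [set k | (K <= k)%N]) ~` A k.
have mG K : measurable (G K).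
  by apply: bigcap_measurable => [|k _]; [exists K => /=|exact: measurableC].
have p0 n : 0 <= p n by rewrite -lee_fin -Ap measure_ge0.
have p1 n : p n <= 1 by rewrite -lee_fin -Ap probability_le1.
(* The events [G K] cover almost every outcome, so they cannot all be null. *)
have [K GK] : exists K, P (G K) != 0.
  apply: contrapT => /forallNP h.
  have nG : P.-negligible (\bigcup_K G K).
    apply: negligible_bigcup => K; apply/negligibleP => //.
    by apply/eqP; apply: contrapT => /negP; exact: h.
  have nT : P.-negligible setT.
    apply: negligibleS (negligibleU nG aeA) => w _.
    have [[N hN]|h'] := pselect (exists N, forall n, (N <= n)%N -> ~ A n w).
      by left; exists N => // k; exact: hN.
    by right.
  have /eqP : P setT = 0 by exact: measure_negligible.
  by rewrite probability_setT onee_eq0.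
pose dl := fine (P (G K)).
have GE : P (G K) = dl%:E by rewrite fineK// fin_num_measure.
have dl0 : 0 < dl.
  by rewrite lt_neqAle fine_ge0 ?measure_ge0// andbT eq_sym -eqe -GE.
have Kbnd L : \sum_(K <= k < L) p k <= - ln dl.
  have h : dl <= \prod_(K <= k < L) (1 - p k).
    rewrite -lee_fin -GE -indA; apply: le_measure; rewrite ?inE//.
      rewrite (_ : mkset _ = \bigcap_(k in [set k | (K <= k < L)%N]) ~` A k)//.
      apply: fin_bigcap_measurable => [|k _]; last exact: measurableC.
      by apply: (@sub_finite_set _ _ `I_L) => // k /= /andP[].
    by move=> w Gw k /andP[Kk _]; exact: Gw.
  have h2 : \prod_(K <= k < L) (1 - p k) <= expR (- \sum_(K <= k < L) p k).
    rewrite -sumrN expR_sum ler_prod// => k _.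
    by rewrite subr_ge0 p1 /= expR_ge1Dx.
  by rewrite lerNr -[X in _ <= X]expRK ler_ln ?posrE ?expR_gt0//; exact: le_trans h2.
exists (\sum_(k < K) p k - ln dl) => N.
have [NK|KN] := leqP N K.
  rewrite (le_trans _ (_ : \sum_(k < K) p k <= _))//; last first.
    by rewrite lerDl; apply: le_trans (Kbnd 0%N); rewrite big_geq.
  rewrite -!(big_mkord xpredT) (big_cat_nat _ NK)//= lerDl.
  by apply: sumr_ge0 => k _.
rewrite -!(big_mkord xpredT) (big_cat_nat _ (ltnW KN))//= lerD2l.
exact: Kbnd.
Qed.

End BorelCantelli.

(** * Chains in space-time boxes and their detection on dyadic grids *)

Section Chains.
Variables (R : realType) (d : nat).
Implicit Types (a b e : pt R d.+1) (X : set (spt R d)) (y x : pt R d).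

(** Time becomes the last coordinate, so that orders, boxes and volumes are those of dimension
    [d.+1] without a special axis. *)
Definition join_time (y : pt R d) (s : R) : pt R d.+1 :=
  fun l => if unlift ord_max l is Some j then y j else s.

Definition coords (p : spt R d) : pt R d.+1 := join_time p.1 p.2.

Lemma join_time_lift y s i : join_time y s (lift ord_max i) = y i.
Proof. by rewrite /join_time liftK. Qed.

Lemma join_time_max y s : join_time y s ord_max = s.
Proof. by rewrite /join_time unlift_none. Qed.

Lemma forall_join_time (Q : R -> R -> Prop) y x s t :
  (forall l, Q (join_time y s l) (join_time x t l)) <->
  (forall i, Q (y i) (x i)) /\ Q s t.
Proof.
split=> [h|[h1 h2] l].
  by split=> [i|]; [have := h (lift ord_max i)|have := h ord_max];
    rewrite ?join_time_lift ?join_time_max.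
by rewrite /join_time; case: unliftP.
Qed.

Lemma ptlt_join_time y x s t :
  ptlt (join_time y s) (join_time x t) <-> ptlt y x /\ s < t.
Proof. exact: (forall_join_time (fun u v => u < v)). Qed.

Lemma ptle_join_time y x s t :
  ptle (join_time y s) (join_time x t) <-> ptle y x /\ s <= t.
Proof. exact: (forall_join_time (fun u v => u <= v)). Qed.

Definition inbox a b : set (spt R d) :=
  [set p | ptlt a (coords p) /\ ptle (coords p) b].

Definition vol a b : R := \prod_l (b l - a l).

Definition space (a : pt R d.+1) : pt R d := fun i => a (lift ord_max i).

Lemma join_time_space a : join_time (space a) (a ord_max) = a.
Proof.
by apply/funext => l; rewrite /join_time; case: unliftP => [j ->|->].
Qed.

Lemma srect_inbox a b :
  srect (space a) (space b) (a ord_max) (b ord_max) = inbox a b.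
Proof.
rewrite -{3}(join_time_space a) -{3}(join_time_space b).
apply/seteqP; split => p; rewrite /srect /inbox /coords /=.
  by move=> [h1 [h2 [h3 h4]]]; split; [apply/ptlt_join_time|apply/ptle_join_time].
by move=> [/ptlt_join_time[? ?] /ptle_join_time[? ?]].
Qed.

Lemma svol_vol a b : svol (space a) (space b) (a ord_max) (b ord_max) = vol a b.
Proof.
rewrite /svol /vol big_ord_recr/=; congr (_ * _); apply: eq_bigr => i _.
by rewrite /space (_ : lift _ _ = widen_ord (leqnSn d) i)//; apply: val_inj; exact: lift_max.
Qed.

Lemma vol_join_time y x s t :
  vol (join_time y s) (join_time x t) = (\prod_i (x i - y i)) * (t - s).
Proof.
rewrite -svol_vol /svol !join_time_max; congr (_ * _).
by apply: eq_bigr => i _; rewrite /space !join_time_lift.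
Qed.

Definition chain X a b (m : nat) : Prop := exists p : 'I_m -> spt R d,
  (forall i, X (p i) /\ inbox a b (p i)) /\
  (forall i j : 'I_m, (i < j)%N -> ptlt (coords (p i)) (coords (p j))).

Lemma HcountE X y x t : Hcount X y x t =
  ereal_sup [set ((m%:R)%:E : \bar R) | m in
    chain X (join_time y 0) (join_time x t)].
Proof.
rewrite /Hcount; congr (ereal_sup (_ @` _)); apply/seteqP; split=> m /= [p [h1 h2]];
  exists p; split=> [i|i j ij].
- have [? [? [? [? ?]]]] := h1 i; split=> //.
  by split; [apply/ptlt_join_time|apply/ptle_join_time].
- by have [? ?] := h2 i j ij; apply/ptlt_join_time.
- by have [? [/ptlt_join_time[? ?] /ptle_join_time[? ?]]] := h1 i.
- by have /ptlt_join_time[? ?] := h2 i j ij.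
Qed.

Lemma chain0 X a b : chain X a b 0.
Proof. by exists (fun=> (fun=> 0, 0)); split=> -[]. Qed.

Lemma chain_leq X a b m n : (n <= m)%N -> chain X a b m -> chain X a b n.
Proof.
move=> nm [p [h1 h2]]; exists (fun i => p (widen_ord nm i)).
by split=> [i|i j ij]; [exact: h1|exact: h2].
Qed.

Lemma chain_sub X a b a' b' m : ptle a' a -> ptle b b' ->
  chain X a b m -> chain X a' b' m.
Proof.
move=> aa bb [p [h1 h2]]; exists p; split=> // i.
have [? [h3 h4]] := h1 i; split=> //; split=> l.
  exact: le_lt_trans (aa l) (h3 l).
exact: le_trans (h4 l) (bb l).
Qed.

Lemma chain_cat X a b e m n : ptle a b -> ptle b e ->
  chain X a b m -> chain X b e n -> chain X a e (m + n)%N.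
Proof.
move=> ab be [p [p1 p2]] [q [q1 q2]].
exists (fun i => match fintype.split i with inl j => p j | inr j => q j end).
split=> [i|i j].
  case: fintype.splitP => k _.
    have [? [h3 h4]] := p1 k; split=> //; split=> // l.
    exact: le_trans (h4 l) (be l).
  have [? [h3 h4]] := q1 k; split=> //; split=> // l.
  exact: le_lt_trans (ab l) (h3 l).
case: fintype.splitP => k ->; case: fintype.splitP => k' ->.
- exact: p2.
- move=> _ l; have [_ [_ h]] := p1 k; have [_ [h' _]] := q1 k'.
  exact: le_lt_trans (h l) (h' l).
- by move=> h; have := ltn_ord k'; rewrite ltnNge (leq_trans (leq_addr k m) (ltnW h)).
- by rewrite ltn_add2l; exact: q2.
Qed.

Section Grid.
Variable k : nat.

Definition cell := {ffun 'I_d.+1 -> 'I_(2 ^ k)}.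

(** The subdivision is relative to the box, so all cells of a box have equal volume and the
    combinatorics of cells is the same for every box. *)
Definition grid a b (u : nat) (l : 'I_d.+1) : R :=
  a l + (b l - a l) * (u%:R / 2 ^+ k).

Definition cell_lo a b (v : cell) : pt R d.+1 := fun l => grid a b (v l) l.
Definition cell_hi a b (v : cell) : pt R d.+1 := fun l => grid a b (v l).+1 l.

Lemma grid0 a b l : grid a b 0 l = a l.
Proof. by rewrite /grid mul0r mulr0 addr0. Qed.

Lemma grid_max a b l : grid a b (2 ^ k) l = b l.
Proof. by rewrite /grid natrX divff ?mulr1 ?subrKC// expf_neq0. Qed.

Lemma ltr_grid a b l u v : a l < b l -> (grid a b u l < grid a b v l) = (u < v)%N.
Proof.
move=> ab; rewrite /grid ltrD2l ltr_pM2l ?subr_gt0//.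
by rewrite ltr_pM2r ?invr_gt0 ?exprn_gt0// ltr_nat.
Qed.

Lemma ler_grid a b l u v : a l < b l -> (grid a b u l <= grid a b v l) = (u <= v)%N.
Proof. by move=> ab; rewrite leNgt ltr_grid// -leqNgt. Qed.

Lemma grid_cell_ex a b l r : a l < r -> r <= b l ->
  exists v : 'I_(2 ^ k), grid a b v l < r <= grid a b v.+1 l.
Proof.
move=> ar rb; have ex : exists u, r <= grid a b u l.
  by exists (2 ^ k)%N; rewrite grid_max.
case: (ex_minnP ex) => -[|u] ru min_u.
  by move: ru; rewrite grid0 leNgt ar.
have uN : (u < 2 ^ k)%N by apply: min_u; rewrite grid_max.
exists (Ordinal uN); rewrite /= ru andbT ltNge; apply/negP => /min_u.
by rewrite ltnn.
Qed.

Lemma vol_cell a b v : vol (cell_lo a b v) (cell_hi a b v) =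
  vol a b / (2 ^+ k) ^+ d.+1.
Proof.
rewrite /vol -exprVn -[X in _ ^+ X]card_ord -prodr_const -big_split/=.
apply: eq_bigr => l _; rewrite /cell_lo /cell_hi /grid -natr1.
by ring.
Qed.

Definition void_cell (X : set (spt R d)) a b (v : cell) : Prop :=
  X `&` inbox (cell_lo a b v) (cell_hi a b v) = set0.

(* A chain of [m] cells is encoded by its [d.+1] increasing coordinate sequences. *)
Definition cell_chains m : {set {ffun 'I_d.+1 -> m.-tuple 'I_(2 ^ k)}} :=
  [set F in ffun_on (mem [set t : m.-tuple 'I_(2 ^ k) |
                           sorted ltn [seq \val i | i <- t]]%SET)]%SET.

Definition chain_cell m (F : {ffun 'I_d.+1 -> m.-tuple 'I_(2 ^ k)}) (i : 'I_m)
  : cell := [ffun l => tnth (F l) i].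

Lemma cell_chains_lt m F (i j : 'I_m) l : F \in cell_chains m -> (i < j)%N ->
  (chain_cell F i l < chain_cell F j l)%N.
Proof.
rewrite inE => /ffun_onP/(_ l); rewrite inE => sF ij; rewrite !ffunE.
have x0 := tnth (F l) i.
have := @sorted_ltn_nth _ ltn ltn_trans (val x0) _ sF i j.
rewrite !inE size_map size_tuple => /(_ (ltn_ord i) (ltn_ord j) ij).
by rewrite !(nth_map x0) ?size_tuple// !(tnth_nth x0).
Qed.

Lemma card_cell_chains m : #|cell_chains m| = ('C(2 ^ k, m) ^ d.+1)%N.
Proof.
rewrite /cell_chains cardsE card_ffun_on card_ord; congr (_ ^ _)%N.
exact: card_ltn_sorted_tuples.
Qed.

Lemma cell_chains_mk m (f : 'I_m -> cell) :
  (forall (i j : 'I_m) l, (i < j)%N -> (f i l < f j l)%N) ->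
  [ffun l => [tuple f i l | i < m]] \in cell_chains m.
Proof.
move=> hf; rewrite inE; apply/ffun_onP => l; rewrite ffunE inE /= -map_comp.
apply: (@homo_sorted _ _ _ (relpre val ltn)) => [i j|].
  exact: hf.
by rewrite -sorted_map val_enum_ord; exact: iota_ltn_sorted.
Qed.

Definition has_cell_chain m (S : {set cell}) : bool :=
  [exists F in cell_chains m, [forall i, chain_cell F i \notin S]].

(** Cells of a cell chain increase strictly in every coordinate, so a grid value separates their
    points; conversely, separated points lie in strictly increasing cells because cells are open
    below and closed above. In this form the level enters only through the set of grid values. *)
Lemma has_cell_chainP X a b m : ptlt a b ->
  has_cell_chain m [set v | `[< void_cell X a b v >]]%SET <->
  exists p : 'I_m -> spt R d,
  (forall i, X (p i) /\ inbox a b (p i)) /\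
  (forall (i j : 'I_m) l, (i < j)%N -> exists u,
     coords (p i) l <= grid a b u l < coords (p j) l).
Proof.
move=> ab; split.
  move=> /'exists_andP[F [FC /forallP hF]].
  have /choice[p hp] i : exists p, X p /\
      inbox (cell_lo a b (chain_cell F i)) (cell_hi a b (chain_cell F i)) p.
    by have := hF i; rewrite inE => /asboolPn/eqP/set0P[p [? ?]]; exists p.
  exists p; split=> [i|i j l ij].
    have [? [h1 h2]] := hp i; split=> //; split=> l.
      by apply: le_lt_trans (h1 l); rewrite -[leLHS](grid0 a b) ler_grid.
    by apply: le_trans (h2 l) _; rewrite -[leRHS](grid_max a b) ler_grid//.
  exists (chain_cell F j l); have [_ [_ h2]] := hp i; have [_ [h1 _]] := hp j.
  apply/andP; split; last exact: h1.
  by apply: le_trans (h2 l) _; rewrite ler_grid// cell_chains_lt.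
move=> [p [h1 h2]].
have /choice[f hf] i : exists v : cell, forall l,
    grid a b (v l) l < coords (p i) l <= grid a b (v l).+1 l.
  have [_ [g1 g2]] := h1 i.
  have /choice[g hg] l := grid_cell_ex (g1 l) (g2 l).
  by exists (finfun g) => l; rewrite ffunE.
apply/'exists_andP; exists [ffun l => [tuple f i l | i < m]]; split.
  apply: cell_chains_mk => i j l ij; have [u /andP[u1 u2]] := h2 i j l ij.
  have /andP[i1 i2] := hf i l; have /andP[j1 j2] := hf j l.
  have : (f i l < u)%N by rewrite -(ltr_grid _ _ (ab l)); exact: lt_le_trans u1.
  move=> h; apply: leq_trans h _; rewrite -ltnS -(ltr_grid _ _ (ab l)).
  exact: lt_le_trans j2.
apply/forallP => i; rewrite inE; apply/asboolPn => h0.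
have : (X `&` inbox (cell_lo a b (f i)) (cell_hi a b (f i))) (p i).
  split; first by case: (h1 i).
  by split=> l; have /andP[] := hf i l.
rewrite (_ : f i = chain_cell [ffun l => [tuple f i0 l | i0 < m]] i); first by rewrite h0.
by apply/ffunP => l; rewrite !ffunE tnth_mktuple.
Qed.

End Grid.

Definition grid_chain k X a b m : bool :=
  has_cell_chain m [set v : cell k | `[< void_cell X a b v >]]%SET.

(** Every grid value of level [k] is also one of level [k'], so the separation persists. *)
Lemma grid_chain_leq k k' X a b m : ptlt a b -> (k <= k')%N ->
  grid_chain k X a b m -> grid_chain k' X a b m.
Proof.
move=> ab kk /(has_cell_chainP _ _ _ ab)[p [h1 h2]]; apply/has_cell_chainP => //.
exists p; split=> // i j l ij; have [u hu] := h2 i j l ij.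
exists (u * 2 ^ (k' - k))%N; rewrite (_ : grid _ _ _ _ _ = grid k a b u l)//.
have e : 2 ^+ k' = 2 ^+ k * 2 ^+ (k' - k) :> R by rewrite -exprD subnKC.
rewrite /grid natrM natrX e; congr (_ + _ * _).
by rewrite -mulf_div divff ?mulr1// expf_neq0.
Qed.

(** A chain has finitely many coordinate gaps, and all of them exceed the mesh once the level is
    large. *)
Lemma chain_grid_chain X a b m : ptlt a b ->
  chain X a b m <-> exists k, grid_chain k X a b m.
Proof.
move=> ab; split; last first.
  move=> [k /(has_cell_chainP _ _ _ ab)[p [h1 h2]]]; exists p; split=> // i j ij l.
  by have [u /andP[]] := h2 i j l ij; exact: le_lt_trans.
move=> [p [h1 h2]].
have /choice[K hK] (ijl : 'I_m * 'I_m * 'I_d.+1) : exists k0, forall k,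
    (k0 <= k)%N -> (ijl.1.1 < ijl.1.2)%N -> exists u,
    coords (p ijl.1.1) ijl.2 <= grid k a b u ijl.2 < coords (p ijl.1.2) ijl.2.
  case: ijl => -[i j] l /=; have [ij|] := ltnP i j; last by exists 0%N.
  have lt_p := h2 i j ij l; have abl := ab l.
  have [k0 hk0] : exists k0 : nat,
      (b l - a l) / (coords (p j) l - coords (p i) l) < k0%:R.
    exists (Num.truncn ((b l - a l) / (coords (p j) l - coords (p i) l))).+1.
    exact: truncnS_gt.
  exists k0 => k k0k _; have [_ [gi _]] := h1 i; have [_ [_ gj]] := h1 j.
  have [v /andP[v1 v2]] := grid_cell_ex k (gi l) (le_trans (ltW lt_p) (gj l)).
  (* The grid value [v.+1] is at most one mesh width above the coordinate of [p i], and the mesh is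
     smaller than the gap because [2 ^ k > k >= k0]. *)
  exists v.+1; rewrite v2 /=.
  apply: (@le_lt_trans _ _ (coords (p i) l + (b l - a l) / 2 ^+ k)).
    rewrite (_ : grid _ _ _ v.+1 _ = grid k a b v l + (b l - a l) / 2 ^+ k).
      by rewrite lerD2r ltW.
    by rewrite /grid -natr1; ring.
  rewrite -ltrBrDl ltr_pdivrMr ?exprn_gt0// mulrC -ltr_pdivrMr ?subr_gt0//.
  apply: lt_le_trans hk0 _; rewrite -natrX ler_nat.
  by apply: leq_trans k0k _; apply: ltnW; exact: ltn_expl.
exists (\max_ijl K ijl)%N; apply/has_cell_chainP => //; exists p; split=> // i j l ij.
by apply: (hK (i, j, l)) => //; exact: leq_bigmax.
Qed.

End Chains.

(** * Law of chain lengths in boxes of given volume *)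

Lemma ffact_leq_expn n m : (n ^_ m <= n ^ m)%N.
Proof.
elim: m n => [|m ih] [|n]//; rewrite ffactSS expnS leq_mul2l/=.
by apply: leq_trans (ih n) _; case: m {ih} => // m; rewrite leq_exp2r.
Qed.

Lemma cvgr_prod (R : realType) (I : finType) (f : I -> nat -> R) (l : I -> R) :
  (forall i, f i k @[k --> \oo] --> l i) ->
  (\prod_i f i k) @[k --> \oo] --> \prod_i l i.
Proof.
move=> fl; have -> : (fun k => \prod_i f i k) = \prod_i f i.
  by apply/funext => k; rewrite fct_prodE.
by elim/big_ind2 : _ => // [|x x' y y' hx hy]; [exact: cvg_cst|exact: cvgM].
Qed.

Section PoissonLaw.
Context (R : realType) (d : nat) (dT : measure_display) (T : measurableType dT).
Variables (P : probability T R) (pts : T -> set (spt R d)).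
Hypothesis hpp : poisson_pp P pts.
Implicit Types a b : pt R d.+1.

(** These are the rectangles about which [poisson_pp] speaks. *)
Definition admissible a b := ptlt a b /\ 0 <= a ord_max.

Definition disjoint_boxes (J : Type) (a b : J -> pt R d.+1) :=
  forall i j, i <> j -> inbox (a i) (b i) `&` inbox (a j) (b j) = set0.

Lemma prob_void (J : finType) (a b : J -> pt R d.+1) (S : {set J}) :
  (forall j, admissible (a j) (b j)) -> disjoint_boxes a b ->
  measurable [set w | forall j, j \in S -> pts w `&` inbox (a j) (b j) = set0] /\
  P [set w | forall j, j \in S -> pts w `&` inbox (a j) (b j) = set0] =
  (\prod_(j in S) expR (- vol (a j) (b j)))%:E.
Proof.
move=> adm dis; have [_ /(_ #|S|)] := hpp.
pose ev (i : 'I_#|S|) := enum_val i.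
move=> /(_ (fun i => space (a (ev i))) (fun i => space (b (ev i)))
  (fun i => a (ev i) ord_max) (fun i => b (ev i) ord_max) (fun=> 0%N)).
have h1 : forall i, ptlt (space (a (ev i))) (space (b (ev i))) /\
    0 <= a (ev i) ord_max /\ a (ev i) ord_max < b (ev i) ord_max.
  by move=> i; have [lt0 ge0] := adm (ev i); split=> // l; exact: lt0.
have h2 : forall i j, i != j ->
    srect (space (a (ev i))) (space (b (ev i))) (a (ev i) ord_max) (b (ev i) ord_max) `&`
    srect (space (a (ev j))) (space (b (ev j))) (a (ev j) ord_max) (b (ev j) ord_max) = set0.
  move=> i j ij; rewrite !srect_inbox; apply: dis => /enum_val_inj/eqP.
  by rewrite (negPf ij).
move=> /(_ h1 h2) [].
rewrite (_ : mkset _ =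
  [set w | forall j, j \in S -> pts w `&` inbox (a j) (b j) = set0]); last first.
  apply/seteqP; split=> w /= h.
    move=> j jS; have := h (enum_rank_in jS j).
    by rewrite srect_inbox /ev enum_rankK_in// II0 card_eq0 => /eqP.
  by move=> i; rewrite srect_inbox II0 card_eq0; apply/eqP/h; exact: enum_valP.
move=> mE ->; split=> //; congr EFin; rewrite [RHS]big_enum_val/=.
by apply: eq_bigr => i _; rewrite svol_vol expr0 mulr1 fact0 divr1.
Qed.

Section Cells.
Variables (k : nat) (I : finType) (a b : I -> pt R d.+1).
Hypotheses (adm : forall i, admissible (a i) (b i)) (dis : disjoint_boxes a b).

Lemma admissible_cell i (v : cell d k) :
  admissible (cell_lo (a i) (b i) v) (cell_hi (a i) (b i) v).
Proof.
have [lt0 ge0] := adm i; split=> [l|].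
  by rewrite /cell_lo /cell_hi ltr_grid.
by apply: le_trans ge0 _; rewrite -[leLHS](grid0 k (a i) (b i)) /cell_lo ler_grid.
Qed.

Lemma disjoint_cells : disjoint_boxes
  (fun j : I * cell d k => cell_lo (a j.1) (b j.1) j.2)
  (fun j : I * cell d k => cell_hi (a j.1) (b j.1) j.2).
Proof.
have sub i (v : cell d k) p : inbox (cell_lo (a i) (b i) v) (cell_hi (a i) (b i) v) p ->
    inbox (a i) (b i) p.
  move=> [h1 h2]; have [lt0 _] := adm i; split=> l.
    by apply: le_lt_trans (h1 l); rewrite -[leLHS](grid0 k (a i) (b i)) /cell_lo ler_grid.
  by apply: le_trans (h2 l) _; rewrite -[leRHS](grid_max k (a i) (b i)) /cell_hi ler_grid.
move=> [i v] [j u] /= ne; apply/seteqP; split=> // p [pi pj].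
have [ij|ij] := pselect (i = j); last first.
  by rewrite -(dis ij); split; [exact: sub pi|exact: sub pj].
subst j; apply: ne; congr (_, _); apply/ffunP => l; apply/val_inj => /=.
have [lt0 _] := adm i; case: pi => [h1 h2]; case: pj => [h3 h4].
have vu : (v l < (u l).+1)%N.
  by rewrite -(ltr_grid k _ _ (lt0 l)); exact: lt_le_trans (h1 l) (h4 l).
have uv : (u l < (v l).+1)%N.
  by rewrite -(ltr_grid k _ _ (lt0 l)); exact: lt_le_trans (h3 l) (h2 l).
by apply/eqP; rewrite eqn_leq -ltnS vu -ltnS uv.
Qed.

Lemma prob_void_cells (S : {set I * cell d k}) :
  measurable [set w | forall j, j \in S -> void_cell (pts w) (a j.1) (b j.1) j.2] /\
  P [set w | forall j, j \in S -> void_cell (pts w) (a j.1) (b j.1) j.2] =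
  (\prod_(j in S) expR (- (vol (a j.1) (b j.1) / (2 ^+ k) ^+ d.+1)))%:E.
Proof.
have [mE PE] := prob_void S (fun j => admissible_cell j.1 j.2) disjoint_cells.
split=> //; rewrite /void_cell PE; congr EFin.
by apply: eq_bigr => j _; rewrite vol_cell.
Qed.

Lemma measurable_void_cell i (v : cell d k) :
  measurable [set w | void_cell (pts w) (a i) (b i) v].
Proof.
have [+ _] := prob_void_cells [set (i, v)]%SET.
rewrite (_ : mkset _ = [set w | void_cell (pts w) (a i) (b i) v])//.
apply/seteqP; split=> w /=; first by move/(_ (i, v)); apply; rewrite inE.
by move=> h j; rewrite inE => /eqP ->.
Qed.

(** The sum runs over the void patterns [S] that leave an increasing sequence of occupied cells. It
    depends on the box only through its volume [V], which is how the location of a box drops out. *)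
Definition grid_chain_prob (V : R) (m : nat) : R :=
  let q := expR (- (V / (2 ^+ k) ^+ d.+1)) in
  \sum_(S : {set cell d k} | has_cell_chain m S)
     \prod_v (if v \in S then q else 1 - q).

Lemma prob_grid_chains (m : I -> nat) :
  measurable [set w | forall i, grid_chain k (pts w) (a i) (b i) (m i)] /\
  P [set w | forall i, grid_chain k (pts w) (a i) (b i) (m i)] =
  (\prod_i grid_chain_prob (vol (a i) (b i)) (m i))%:E.
Proof.
exact: (prob_block_statistics (fun i => has_cell_chain (m i))
  measurable_void_cell (fun S => (prob_void_cells S).2)).
Qed.

End Cells.

Definition chain_event a b m : set T := [set w | chain (pts w) a b m].

(** The grid events increase with the level to the chain event: the countable union gives
    measurability, and continuity from below gives the limit. *)
Lemma chains_grid_limit (I : finType) (a b : I -> pt R d.+1) (m : I -> nat) :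
  (forall i, admissible (a i) (b i)) -> disjoint_boxes a b ->
  measurable [set w | forall i, chain (pts w) (a i) (b i) (m i)] /\
  (\prod_i grid_chain_prob k (vol (a i) (b i)) (m i)) @[k --> \oo] -->
  fine (P [set w | forall i, chain (pts w) (a i) (b i) (m i)]).
Proof.
move=> adm dis.
pose F k := [set w | forall i, grid_chain k (pts w) (a i) (b i) (m i)].
have mF k : measurable (F k) by have [] := prob_grid_chains k adm dis m.
have FE : [set w | forall i, chain (pts w) (a i) (b i) (m i)] = \bigcup_k F k.
  apply/seteqP; split=> w /=.
    move=> h; have /choice[K hK] i : exists k, grid_chain k (pts w) (a i) (b i) (m i).
      by apply/chain_grid_chain => //; have [] := adm i.
    exists (\max_i K i)%N => // i; apply: grid_chain_leq (hK i).
      by have [] := adm i.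
    exact: leq_bigmax.
  move=> [k _ Fk] i; apply/chain_grid_chain; first by have [] := adm i.
  by exists k; exact: Fk.
have mU : measurable (\bigcup_k F k) by exact: bigcup_measurable.
rewrite FE; split=> //.
have : P (F k) @[k --> \oo] --> P (\bigcup_k F k).
  apply: nondecreasing_cvg_mu => // k k' kk; apply/subsetPset => w Fk i.
  by apply: grid_chain_leq kk (Fk i); have [] := adm i.
rewrite -[X in _ --> X]fineK ?fin_num_measure// => /fine_cvgP[_].
apply: cvg_trans; apply: near_eq_cvg; near=> k => /=.
by have [_ ->] := prob_grid_chains k adm dis m.
Unshelve. all: by end_near. Qed.

Definition chain_prob (V : R) (m : nat) : R :=
  lim (grid_chain_prob k V m @[k --> \oo]).

Lemma chain_eventP a b m : admissible a b ->
  [/\ measurable (chain_event a b m),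
      P (chain_event a b m) = (chain_prob (vol a b) m)%:E &
      grid_chain_prob k (vol a b) m @[k --> \oo] --> chain_prob (vol a b) m].
Proof.
move=> adm.
have dis : disjoint_boxes (fun=> a : pt R d.+1) (fun _ : 'I_1 => b).
  by move=> i j; rewrite !ord1.
have [] := chains_grid_limit (fun=> m) (fun=> adm) dis.
rewrite (_ : mkset _ = chain_event a b m) => [mE|]; last first.
  by apply/seteqP; split=> w /=; [move/(_ ord0)|].
under eq_fun do rewrite big_ord1.
move=> cv; have e : chain_prob (vol a b) m = fine (P (chain_event a b m)).
  exact: cvg_lim.
by split; rewrite ?e// fineK// fin_num_measure.
Qed.

Lemma prob_chains (I : finType) (a b : I -> pt R d.+1) (m : I -> nat) :
  (forall i, admissible (a i) (b i)) -> disjoint_boxes a b ->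
  P [set w | forall i, chain (pts w) (a i) (b i) (m i)] =
  (\prod_i chain_prob (vol (a i) (b i)) (m i))%:E.
Proof.
move=> adm dis; have [mE cv] := chains_grid_limit m adm dis.
rewrite -[LHS]fineK ?fin_num_measure//; congr EFin.
apply: (cvg_unique _ cv) => //; apply: cvgr_prod => i.
by have [] := chain_eventP (m i) (adm i).
Qed.

Lemma prob_chains_split (I : finType) (a b : I -> pt R d.+1) (m : I -> nat)
  (S A : {set I}) :
  (forall i, admissible (a i) (b i)) -> disjoint_boxes a b ->
  (forall j, j \in S -> j \notin A) ->
  P (split_event (fun i => chain_event (a i) (b i) (m i)) S A) =
  ((\prod_(i in S) chain_prob (vol (a i) (b i)) (m i)) *
   (\prod_(i in A) (1 - chain_prob (vol (a i) (b i)) (m i))))%:E.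
Proof.
move=> adm dis; apply: prob_split_event => [i|S'].
  by have [] := chain_eventP (m i) (adm i).
(* An index outside [S'] is assigned the length 0, which is always attained and contributes the
   factor 1. *)
rewrite (_ : mkset _ = [set w | forall i, chain (pts w) (a i) (b i)
    (if i \in S' then m i else 0)]); last first.
  apply/seteqP; split=> w h i.
    by case: ifPn => [/h//|_]; exact: chain0.
  by move=> iS; have := h i; rewrite iS.
rewrite prob_chains// [in RHS]big_mkcond/=; congr EFin; apply: eq_bigr => i _.
case: ifPn => // _; have [_ + _] := chain_eventP 0 (adm i).
rewrite (_ : chain_event _ _ _ = setT); last first.
  by apply/seteqP; split=> // w _; exact: chain0.
by rewrite probability_setT => -[].
Qed.

Lemma chain_prob_itv a b m : admissible a b ->
  0 <= chain_prob (vol a b) m <= 1.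
Proof.
move=> adm; have [mE e _] := chain_eventP m adm.
by rewrite -!lee_fin -e measure_ge0 probability_le1.
Qed.

(** Union bound over all cell chains: each requires [m] distinct occupied cells, and a cell of
    volume [v] is occupied with probability [1 - expR (- v) <= v]. The bound is uniform in [k] and
    therefore survives the limit. *)
Lemma grid_chain_prob_le k a b m : admissible a b ->
  grid_chain_prob k (vol a b) m <= vol a b ^+ m / m`!%:R ^+ d.+1.
Proof.
move=> adm; set V := vol a b.
have V0 : 0 < V.
  by apply: prodr_gt0 => l _; rewrite subr_gt0; have [+ _] := adm; apply.
have dis : disjoint_boxes (fun=> a : pt R d.+1) (fun _ : 'I_1 => b).
  by move=> i j; rewrite !ord1.
have [_] := prob_grid_chains k (fun=> adm) dis (fun=> m).
rewrite big_ord1 -lee_fin => <-.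
set q := expR (- (V / (2 ^+ k) ^+ d.+1)).
pose W (v : cell d k) := [set w | void_cell (pts w) a b v].
have mW v : measurable (W v) by exact: (measurable_void_cell (fun=> adm) dis ord0).
have PW (S : {set cell d k}) : P [set w | forall v, v \in S -> W v w] =
    (\prod_(v in S) q)%:E.
  have dis' : disjoint_boxes (cell_lo a b (k := k)) (cell_hi a b (k := k)).
    by move=> u v uv; apply: (disjoint_cells (fun=> adm) dis (i := (ord0, u))
      (j := (ord0, v))) => -[].
  have adm' v : admissible (cell_lo a b v) (cell_hi a b (k := k) v).
    exact: (admissible_cell (fun=> adm) (ord0 : 'I_1)).
  have [_ ->] := prob_void S adm' dis'.
  by congr EFin; apply: eq_bigr => v _; rewrite vol_cell.
pose E (F : {ffun 'I_d.+1 -> m.-tuple 'I_(2 ^ k)}) :=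
  split_event W finset.set0 [set chain_cell F i | i : 'I_m]%SET.
have mE F : measurable (E F) by exact: measurable_split_event.
apply: (@le_trans _ _ (P [set w | exists2 F, F \in cell_chains d k m & E F w])).
  apply: le_measure; rewrite ?inE.
  - by have [] := prob_grid_chains k (fun=> adm) dis (fun=> m).
  - exact: measurable_ex_fin.
  move=> w /(_ ord0) /'exists_andP[F [FC /forallP hF]]; exists F => //.
  split=> v; first by rewrite inE.
  by move=> /imsetP[i _ ->]; apply/asboolPn; have := hF i; rewrite inE.
apply: (le_trans (union_bound_fin P (fun F _ => mE F))).
apply: (@le_trans _ _ (\sum_(F in cell_chains d k m)
   ((V / (2 ^+ k) ^+ d.+1) ^+ m)%:E)).
  apply: lee_sum => F FC; rewrite /E (prob_split_event mW PW); last by move=> j; rewrite inE.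
  rewrite big_set0 mul1r prodr_const card_imset; last first.
    have ne (i j : 'I_m) : (i < j)%N -> chain_cell F i <> chain_cell F j.
      by move=> ij e; have := cell_chains_lt ord0 FC ij; rewrite e ltnn.
    by move=> i j e; apply: val_inj; case: (ltngtP i j) => // /ne; rewrite e.
  rewrite card_ord lee_fin lerXn2r ?nnegrE//.
  - by rewrite subr_ge0 -expR0 ler_expR oppr_le0 divr_ge0 ?exprn_ge0// ltW.
  - by rewrite divr_ge0 ?exprn_ge0// ltW.
  by rewrite lerBlDl -lerBlDr; exact: expR_ge1Dx.
rewrite sumEFin lee_fin sumr_const card_cell_chains -[leLHS]mulr_natl.
have C0 : (0 : R) < (m`!)%:R ^+ d.+1 by rewrite exprn_gt0// ltr0n fact_gt0.
have N0 : (0 : R) < 2 ^+ k by rewrite exprn_gt0.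
(* A binomial coefficient times the factorial is a falling factorial, hence at most [(2 ^+ k) ^+ m];
   after this the powers of [2 ^+ k] cancel. *)
have CN : ('C(2 ^ k, m) * m`!)%:R ^+ d.+1 <= ((2 ^+ k) ^+ m) ^+ d.+1 :> R.
  rewrite lerXn2r ?nnegrE ?exprn_ge0// -!natrX ler_nat bin_ffact.
  exact: ffact_leq_expn.
rewrite ler_pdivlMr// expr_div_n.
rewrite (_ : _ * _ * _ = V ^+ m * (('C(2 ^ k, m) * m`!)%:R ^+ d.+1 /
    ((2 ^+ k) ^+ m) ^+ d.+1)); last first.
  rewrite natrM exprMn (natrX _ 'C(_, _)) (exprAC (2 ^+ k : R) d.+1 m).
  by rewrite mulrCA -mulrA; congr (_ * _); rewrite mulrAC.
by rewrite ler_piMr ?exprn_ge0 ?(ltW V0)// ler_pdivrMr ?exprn_gt0// mul1r.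
Qed.

Lemma chain_prob_le a b m : admissible a b ->
  chain_prob (vol a b) m <= vol a b ^+ m / m`!%:R ^+ d.+1.
Proof.
move=> adm; have [_ _ cv] := chain_eventP m adm.
rewrite -(cvg_lim _ cv)//; apply: limr_le.
  by apply/cvg_ex; exists (chain_prob (vol a b) m).
by near=> k; exact: grid_chain_prob_le.
Unshelve. all: by end_near. Qed.

End PoissonLaw.

(** * Cubes with a corner at the origin *)

Lemma cvge_fin_near (R : realType) (f : nat -> \bar R) (l e : R) : 0 < e ->
  f n @[n --> \oo] --> l%:E ->
  \forall n \near \oo, ((l - e)%:E <= f n <= (l + e)%:E)%E.
Proof.
move=> e0 /fine_cvgP[ffin /cvgrPdist_le/(_ e e0) fe]; near=> n.
have fn : f n \is a fin_num by near: n.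
have : `|l - fine (f n)| <= e by near: n.
by rewrite -(fineK fn) !lee_fin ler_norml => /andP[? ?]; apply/andP; split; lra.
Unshelve. all: by end_near. Qed.

Section Cubes.
Variables (R : realType) (d : nat).
Implicit Types X : set (spt R d).

Definition diag (s : R) : pt R d.+1 := fun=> s.

Lemma vol_diag s t : vol (diag s) (diag t) = (t - s) ^+ d.+1.
Proof. by rewrite -[in RHS](card_ord d.+1) -prodr_const. Qed.

Lemma Hcount_cubeE X (n : nat) :
  Hcount X (@ptzero R d) (ptscale n%:R (@ptone R d)) n%:R =
  ereal_sup [set ((m%:R)%:E : \bar R) | m in chain X (diag 0) (diag n%:R)].
Proof.
rewrite HcountE (_ : join_time _ 0 = diag 0).
  rewrite (_ : join_time _ _ = diag n%:R)//; apply/funext => l.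
  by rewrite /join_time /ptscale /ptone; case: unlift => // _; rewrite mulr1.
by apply/funext => l; rewrite /join_time; case: unlift.
Qed.

(** The hypothesis concerns integer sides; monotonicity of chains in the box extends it to real
    sides [s], half of [e] paying for the rounding of [s]. *)
Lemma cube_limit X c :
  (fun n : nat => ((n%:R)^-1)%:E * Hcount X (@ptzero R d)
                   (ptscale n%:R (@ptone R d)) n%:R)%E @ \oo --> c%:E ->
  [/\ 0 <= c,
      forall e, 0 < e -> exists S, forall s m, S <= s ->
        chain X (diag 0) (diag s) m -> m%:R <= (c + e) * s &
      forall e, 0 < e -> exists S, forall s, S <= s ->
        exists2 m, chain X (diag 0) (diag s) m & (c - e) * s <= m%:R].
Proof.
set H := fun n : nat => Hcount X (@ptzero R d) (ptscale n%:R (@ptone R d)) n%:R.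
move=> cv.
have H0 n : (0 <= H n)%E.
  by rewrite /H Hcount_cubeE; apply: ereal_sup_ubound; exists 0%N => //; exact: chain0.
have c0 : 0 <= c.
  rewrite -lee_fin -(cvg_lim _ cv)//; apply: lime_ge.
    by apply/cvg_ex; eexists; exact: cv.
  by near=> n; rewrite mule_ge0 ?H0// lee_fin invr_ge0.
have key e : 0 < e -> exists N : nat, forall n, (N <= n)%N ->
    (((c - e) * n%:R)%:E <= H n <= ((c + e) * n%:R)%:E)%E.
  move=> e0; have [N _ hN] := cvge_fin_near e0 cv.
  exists N.+1 => n Nn; have n0 : 0 < n%:R :> R by rewrite ltr0n (leq_trans _ Nn).
  have /andP[] := hN n (ltnW Nn).
  by rewrite lee_pdivrMl// lee_pdivlMl// -!EFinM ![n%:R * _]mulrC => -> ->.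
split=> // e e0.
  have e2 : 0 < e / 2 by rewrite divr_gt0.
  have [N hN] := key _ e2.
  (* The second threshold is what gives [(c + e / 2) * (s + 1) <= (c + e) * s]. *)
  exists (Num.max N%:R ((c + e / 2) * (e / 2)^-1)) => s m.
  rewrite ge_max => /andP[Ns es] ch.
  have s0 : 0 <= s by apply: le_trans Ns.
  have /(_ _)/wrap[|/andP[_]] := hN (Num.truncn s).+1.
    by rewrite -(@ler_nat R); apply: le_trans Ns _; rewrite ltW// truncnS_gt.
  move=> h; have : ((m%:R)%:E <= ((c + e / 2) * (Num.truncn s).+1%:R)%:E :> \bar R)%E.
    apply: le_trans h; rewrite /H Hcount_cubeE; apply: ereal_sup_ubound.
    exists m => //; apply: chain_sub ch => // l; rewrite /diag ltW// truncnS_gt//.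
  rewrite lee_fin => /le_trans; apply.
  apply: (@le_trans _ _ ((c + e / 2) * (s + 1))).
    by rewrite ler_wpM2l ?addr_ge0 ?(ltW e2)// -natr1 lerD2r truncn_le.
  by move: es; rewrite ler_pdivrMr// => es; nra.
have e2 : 0 < e / 2 by rewrite divr_gt0.
have [N hN] := key _ e2.
exists (Num.max (N%:R + 1) (c * (e / 2)^-1)) => s.
rewrite ge_max => /andP[Ns es].
have s1 : 1 <= s by apply: le_trans Ns; rewrite lerDr.
have [ce|ce] := lerP (c - e) 0.
  exists 0%N; first exact: chain0.
  by rewrite mulr_le0_ge0// (le_trans _ s1).
have st := truncn_le s; have := truncnS_gt s; rewrite -natr1 => st'.
have s0 : 0 <= s by rewrite (le_trans _ s1).
have /(_ _)/wrap[|/andP[h _]] := hN (Num.truncn s).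
  by apply: ltnW; rewrite -(ltr_nat R); lra.
(* Strictness lets the length of an actual chain, and not only the supremum, exceed the bound. *)
have : (((c - e) * s)%:E < H (Num.truncn s))%E.
  apply: lt_le_trans h; rewrite lte_fin.
  move: es; rewrite ler_pdivrMr// => es.
  by nra.
rewrite /H Hcount_cubeE => /ereal_sup_gt[_ [m ch <-]]; rewrite lte_fin => ltm.
exists m; last exact: ltW.
by apply: chain_sub ch => // l; rewrite /diag; rewrite st s0.
Unshelve. all: by end_near. Qed.

Lemma disjoint_steps (f : nat -> pt R d.+1) : (forall i, ptle (f i) (f i.+1)) ->
  disjoint_boxes f (fun i => f i.+1).
Proof.
move=> hf.
have mono i j : (i <= j)%N -> ptle (f i) (f j).
  move=> /subnK <-; elim: (j - i)%N => [//|n ih] l; rewrite addSn.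
  exact: le_trans (ih l) (hf _ l).
have disj i j : (i < j)%N -> inbox (f i) (f i.+1) `&` inbox (f j) (f j.+1) = set0.
  move=> ij; apply/seteqP; split=> // p [[_ h1] [h2 _]].
  have := lt_le_trans (h2 ord0) (le_trans (h1 ord0) (mono _ _ ij ord0)).
  by rewrite ltxx.
move=> i j /eqP; case: ltngtP => // ij _; first exact: disj.
by rewrite setIC; exact: disj.
Qed.

End Cubes.

(** * Summable upper tails along a geometric sequence of cubes *)

Lemma geometric_bracket (R : realType) (rho x : R) : 1 < rho -> 1 <= x ->
  exists k, rho ^+ k <= x < rho ^+ k.+1.
Proof.
move=> rho1 x1.
have ex : exists k, x < rho ^+ k.
  have k0 : 0 < rho - 1 by rewrite subr_gt0.
  exists (Num.truncn ((rho - 1)^-1 * x)).+1; set n := _.+1.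
  have hn : x < (rho - 1) * n%:R.
    by rewrite mulrC -ltr_pdivrMr// mulrC truncnS_gt.
  apply: lt_le_trans hn _; elim: n => [|n ih]; first by rewrite mulr0 expr0.
  have : 1 <= rho ^+ n by rewrite exprn_ege1// ltW.
  by rewrite exprS -natr1; nra.
case: (ex_minnP ex) => -[|k] xk min_k; first by move: xk; rewrite expr0 ltNge x1.
exists k; rewrite xk andbT leNgt; apply/negP => /min_k; rewrite ltnn//.
Qed.

Section UpperTail.
Context (R : realType) (d : nat) (dT : measure_display) (T : measurableType dT).
Variables (P : probability T R) (pts : T -> set (spt R d)) (c : R).
Hypothesis hpp : poisson_pp P pts.
Hypothesis hc : {ae P, forall w,
  (fun n : nat => ((n%:R)^-1)%:E * Hcount (pts w) (@ptzero R d)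
                    (ptscale n%:R (@ptone R d)) n%:R)%E @ \oo --> c%:E}.

(** Since [c] is deterministic, one outcome at which the convergence holds suffices. *)
Lemma limit_constant_ge0 : 0 <= c.
Proof.
have [B [mB PB sB]] := hc.
have [w wB] : exists w, ~ B w.
  apply: contrapT => /forallNP h; have BT : B = setT.
    by apply/seteqP; split=> // w _; exact: contrapT (h w).
  by move: PB; rewrite BT probability_setT => /eqP; rewrite onee_eq0.
by have /contrapT/cube_limit[] := contra_not (sB w) wB.
Qed.

(** Superadditivity along the diagonal: a chain of length [m k] from [f k] to [f k.+1], appended to
    a nearly optimal chain up to [f k], would violate the upper bound for the cube up to [f k.+1]
    when [k] is large. It therefore occurs finitely often almost surely, and disjointness of the
    boxes makes the probabilities summable. *)
Lemma upper_tail_summable (a rho e : R) : 0 < a -> 1 < rho -> 0 < e ->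
  exists M, forall N, \sum_(k < N) chain_prob d ((a * rho ^+ k) ^+ d.+1)
    (Num.truncn ((c + e) * (a * rho ^+ k))).+1 <= M.
Proof.
move=> a0 rho1 e0.
have r1 : 0 < rho - 1 by rewrite subr_gt0.
have rho0 : 0 < rho by rewrite (lt_trans _ rho1).
(* With this factor the step from [a' * rho ^+ k] to [a' * rho ^+ k.+1] is exactly
   [a * rho ^+ k]. *)
pose a' := a / (rho - 1).
have a'0 : 0 < a' by rewrite divr_gt0.
pose f k := @diag R d (a' * rho ^+ k).
pose m k := (Num.truncn ((c + e) * (a * rho ^+ k))).+1.
have rk0 k : 0 < rho ^+ k by rewrite exprn_gt0.
have ff k : ptlt (f k) (f k.+1).
  by move=> l; rewrite /f /diag ltr_pM2l// exprS ltr_pMl.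
have adm k : admissible (f k) (f k.+1).
  by split=> //; rewrite /f /diag mulr_ge0 ?(ltW a'0)// ltW.
have volf k : vol (f k) (f k.+1) = (a * rho ^+ k) ^+ d.+1.
  rewrite vol_diag (exprS rho); congr (_ ^+ _); rewrite /a'; field.
  by rewrite gt_eqF.
have dis : disjoint_boxes f (fun k => f k.+1).
  by apply: disjoint_steps => i l; rewrite ltW// ff.
have mA k : measurable (chain_event pts (f k) (f k.+1) (m k)).
  by have [] := chain_eventP hpp (m k) (adm k).
apply: (@bounded_sum_of_ae_finitely_often _ _ _ P _
  (fun k => chain_prob d ((a * rho ^+ k) ^+ d.+1) (m k)) mA) => [k|K L|].
- by have [_ ->] := chain_eventP hpp (m k) (adm k); rewrite volf.
- have disL : disjoint_boxes (fun i : 'I_L => f i) (fun i : 'I_L => f i.+1).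
    by move=> i j ij; apply: dis => /val_inj.
  have := @prob_chains_split _ _ _ _ _ _ hpp 'I_L _ _ (fun i => m i) finset.set0
    [set i : 'I_L | (K <= i)%N]%SET (fun i => adm i) disL.
  move=> /(_ _)/wrap[|]; first by move=> j; rewrite inE.
  rewrite (_ : split_event _ _ _ = [set w | forall k, (K <= k < L)%N ->
     ~ chain_event pts (f k) (f k.+1) (m k) w]); last first.
    apply/seteqP; split=> w.
      by move=> [_ h] k /andP[Kk kL]; apply: (h (Ordinal kL)); rewrite inE.
    by move=> h; split=> i; rewrite inE// => Ki; apply: h; rewrite Ki ltn_ord.
  move=> ->; rewrite big_set0 mul1r big_geq_mkord; congr EFin.
  apply: eq_big => [i|i _]; first by rewrite inE.
  by rewrite volf.
apply: filterS hc => w /cube_limit[c0 up lo].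
(* In units of [a' * rho ^+ k], the errors of the two cube bounds add up to [e' * (rho + 1)]; this
   is made half of the excess [e * (rho - 1)]. *)
pose e' := e * (rho - 1) / (rho + 1) / 2.
have e'0 : 0 < e' by rewrite !divr_gt0 ?mulr_gt0// addr_gt0.
have [S1 hS1] := up _ e'0; have [S2 hS2] := lo _ e'0.
pose S := Num.max 1 (Num.max S1 S2).
have [N hN] : exists N, S / a' <= rho ^+ N.
  have [k /andP[_ /ltW hk]] := @geometric_bracket _ rho (Num.max 1 (S / a')) rho1
    ltac:(by rewrite le_max lexx).
  by exists k.+1; apply: le_trans hk; rewrite le_max lexx orbT.
exists N => k Nk ch.
have Sk : S <= a' * rho ^+ k.
  rewrite mulrC -ler_pdivrMr//; apply: le_trans hN _.
  by rewrite ler_weXn2l// ltW.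
have Sk' : S <= a' * rho ^+ k.+1.
  apply: le_trans Sk _; rewrite ltW//; exact: (ff k ord0).
have S2S : S2 <= S by rewrite !le_max lexx !orbT.
have S1S : S1 <= S by rewrite !le_max lexx !orbT.
have [m0 ch0 hm0] := hS2 _ (le_trans S2S Sk).
have fk0 : ptle (@diag R d 0) (f k).
  by move=> l; rewrite /f /diag mulr_ge0 ?(ltW a'0)// ltW.
have := hS1 _ _ (le_trans S1S Sk') (chain_cat fk0 (fun l => ltW (ff k l)) ch0 ch).
have mk : (c + e) * (a * rho ^+ k) < (m k)%:R by exact: truncnS_gt.
have e'E : e' * (rho + 1) = e * (rho - 1) / 2.
  by rewrite /e'; field; rewrite gt_eqF// addr_gt0.
have aE : a = a' * (rho - 1) by rewrite /a' divfK// gt_eqF.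
move: hm0 mk; rewrite natrD exprS aE.
set u := a' * rho ^+ k; have u0 : 0 < u by rewrite mulr_gt0.
rewrite (_ : a' * (rho - 1) * rho ^+ k = (rho - 1) * u); last by rewrite /u; ring.
rewrite (_ : a' * (rho * rho ^+ k) = rho * u); last by rewrite /u; ring.
move=> h1 h2 h3.
have := mulr_gt0 (mulr_gt0 e0 r1) u0.
have : e' * (rho + 1) * u = e * (rho - 1) * u / 2 by rewrite e'E; ring.
lra.
Qed.

End UpperTail.

(** * Upper bound for scaled boxes *)

Lemma vol_ptscale (R : realType) (d : nat) (s : R) (a b : pt R d.+1) :
  vol (ptscale s a) (ptscale s b) = s ^+ d.+1 * vol a b.
Proof.
rewrite /vol -[X in _ ^+ X](card_ord d.+1) -prodr_const -big_split/=.
by apply: eq_bigr => l _; rewrite /ptscale mulrBr.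
Qed.

Section UpperLimit.
Context (R : realType) (d : nat) (dT : measure_display) (T : measurableType dT).
Variables (P : probability T R) (pts : T -> set (spt R d)) (c : R).
Hypothesis hpp : poisson_pp P pts.
Hypothesis hc : {ae P, forall w,
  (fun n : nat => ((n%:R)^-1)%:E * Hcount (pts w) (@ptzero R d)
                    (ptscale n%:R (@ptone R d)) n%:R)%E @ \oo --> c%:E}.

(* For rho^k <= n <= rho^(k+1) the box n(a,b] is contained in rho^k(a',b'],
   where (a',b'] is (a,b] enlarged by the factor 1 + 2h. *)
Lemma ae_chain_upper (a b : pt R d.+1) (v r : R) :
  ptlt a b -> a ord_max = 0 -> 0 < v -> v ^+ d.+1 = vol a b -> c * v < r ->
  {ae P, forall w, exists N : nat, forall n m, (N <= n)%N ->
     chain (pts w) (ptscale n%:R a) (ptscale n%:R b) m -> m%:R <= r * n%:R}.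
Proof.
move=> ab amax v0 vE cvr; have c0 := limit_constant_ge0 hc.
(* The slack is shared: [e] places [q = (c + e) * v] halfway between [c * v] and [r], and [h] below
   enlarges the box just so much that [q * (1 + 2 * h) = r]. *)
pose e := (r - c * v) / (2 * v).
have e0 : 0 < e by rewrite divr_gt0 ?subr_gt0// mulr_gt0.
pose q := (c + e) * v.
have q0 : 0 < q by rewrite mulr_gt0// ltr_pwDr.
have qr : q < r.
  have : e * v = (r - c * v) / 2 by rewrite /e; field; rewrite gt_eqF.
  by rewrite /q; move: e {e0 q q0} => e' ev; lra.
pose h := (r - q) / (2 * q).
have h0 : 0 < h by rewrite divr_gt0 ?subr_gt0// mulr_gt0.
have qh : q * (1 + 2 * h) = r by rewrite /h; field; rewrite gt_eqF.
pose wd l := b l - a l.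
have wd0 l : 0 < wd l by rewrite subr_gt0.
pose A := \sum_l (`|a l| + `|b l|) / wd l.
have term0 l : 0 <= (`|a l| + `|b l|) / wd l.
  by apply: divr_ge0; [exact: addr_ge0|exact: ltW].
have A0 : 0 <= A by apply: sumr_ge0 => l _.
(* Scaling by a factor between 1 and [1 + kap] moves each coordinate of the corners by at most [h]
   times the width of the box in that direction. *)
pose kap := h / (A + 1).
have A1 : 0 < A + 1 by rewrite ltr_wpDl.
have kap0 : 0 < kap by rewrite divr_gt0.
have kapP l : kap * (`|a l| + `|b l|) <= h * wd l.
  have : (`|a l| + `|b l|) / wd l <= A + 1.
    rewrite (le_trans _ (_ : A <= _)) ?lerDl// /A (bigD1 l)//= lerDl.
    by apply: sumr_ge0 => j _.
  rewrite ler_pdivrMr// => /(ler_wpM2l (ltW h0)) hl.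
  by rewrite /kap mulrAC ler_pdivrMr// (le_trans hl)// mulrA mulrAC.
pose rho := 1 + kap.
have rho1 : 1 < rho by rewrite ltrDl.
(* In the time direction the box is enlarged only upwards, since it must not start before time 0. *)
pose a' : pt R d.+1 := fun l => if l == ord_max then 0 else a l - h * wd l.
pose b' : pt R d.+1 := fun l => a' l + (1 + 2 * h) * wd l.
have h21 : 0 < 1 + 2 * h by rewrite addr_gt0// mulr_gt0.
have v'0 : 0 < v * (1 + 2 * h) by rewrite mulr_gt0.
have rk0 k : 0 < rho ^+ k by rewrite exprn_gt0// (lt_trans _ rho1).
pose fa k := ptscale (rho ^+ k) a'; pose fb k := ptscale (rho ^+ k) b'.
have adm k : admissible (fa k) (fb k).
  split=> [l|]; last by rewrite /fa /ptscale /a' eqxx mulr0.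
  by rewrite /fa /fb /ptscale ltr_pM2l// /b' ltrDl mulr_gt0.
have vol' k : vol (fa k) (fb k) = (v * (1 + 2 * h) * rho ^+ k) ^+ d.+1.
  rewrite vol_ptscale 2!exprMn vE mulrC; congr (_ * _).
  rewrite /vol mulrC -[X in _ ^+ X](card_ord d.+1) -prodr_const -big_split/=.
  by apply: eq_bigr => l _; rewrite /b' addrAC subrr add0r.
have [M hM] := upper_tail_summable hpp hc v'0 rho1 e0.
pose m k := (Num.truncn ((c + e) * (v * (1 + 2 * h) * rho ^+ k))).+1.
have mE k : measurable (chain_event pts (fa k) (fb k) (m k)).
  by have [] := chain_eventP hpp (m k) (adm k).
have PE k : (P (chain_event pts (fa k) (fb k) (m k)) <=
    (chain_prob d ((v * (1 + 2 * h) * rho ^+ k) ^+ d.+1) (m k))%:E)%E.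
  by have [_ ->] := chain_eventP hpp (m k) (adm k); rewrite vol'.
have := borel_cantelli mE PE hM; apply: filterS => w [K hK].
exists (Num.truncn (rho ^+ K)).+1 => n m0 Kn ch.
have n1 : 1 <= n%:R :> R by rewrite ler1n (leq_trans _ Kn).
have rKn : rho ^+ K <= n%:R.
  apply: le_trans (_ : (Num.truncn (rho ^+ K)).+1%:R <= _);
    by rewrite ?ler_nat// ltW// truncnS_gt.
have [k /andP[k1 k2]] := geometric_bracket rho1 n1.
have Kk : (K <= k)%N.
  rewrite leqNgt; apply/negP => kK; have := le_lt_trans rKn k2.
  by rewrite ltNge ler_weXn2l// ltW.
have dk : 0 <= n%:R - rho ^+ k <= kap * rho ^+ k.
  by rewrite subr_ge0 k1 lerBlDl; move: k2; rewrite exprS /rho mulrDl mul1r => /ltW.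
have hab l : (n%:R - rho ^+ k) * (`|a l| + `|b l|) <= rho ^+ k * (h * wd l).
  case/andP: dk => dk1 dk2.
  apply: (@le_trans _ _ (kap * rho ^+ k * (`|a l| + `|b l|))).
    by rewrite ler_wpM2r// addr_ge0.
  by rewrite mulrAC mulrC ler_pM2l.
have ale l : - `|a l| <= a l by rewrite lerNl -normrN ler_norm.
have ble l : b l <= `|b l| by exact: ler_norm.
have dk0 : 0 <= n%:R - rho ^+ k by case/andP: dk.
have sub : chain (pts w) (fa k) (fb k) m0.
  apply: chain_sub ch => l; rewrite /fa /fb /ptscale.
    rewrite /a'; case: ifPn => [/eqP->|_]; first by rewrite amax !mulr0.
    have := hab l; have := mulr_ge0 dk0 (normr_ge0 (b l)).
    have : 0 <= (n%:R - rho ^+ k) * (a l + `|a l|) by rewrite mulr_ge0// -lerBlDr sub0r.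
    by lra.
  have b'le : b l + h * wd l <= b' l.
    rewrite /b' /a'; case: ifPn => [/eqP->|_]; rewrite /wd ?amax.
      have := mulr_gt0 h0 (wd0 ord_max); rewrite /wd amax; lra.
    by lra.
  apply: (@le_trans _ _ (rho ^+ k * (b l + h * wd l))); last by rewrite ler_pM2l.
  have := hab l; have := mulr_ge0 dk0 (normr_ge0 (a l)).
  have : 0 <= (n%:R - rho ^+ k) * (`|b l| - b l) by rewrite mulr_ge0// subr_ge0.
  by lra.
have lt_m : (m0 < m k)%N.
  rewrite ltnNge; apply/negP => le_m.
  by apply: (hK k Kk); exact: chain_leq sub.
have : m0%:R <= (c + e) * (v * (1 + 2 * h) * rho ^+ k).
  apply: (@le_trans _ _ (Num.truncn ((c + e) * (v * (1 + 2 * h) * rho ^+ k)))%:R).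
    by rewrite ler_nat -ltnS.
  rewrite truncn_le; apply: mulr_ge0; last exact: ltW (mulr_gt0 v'0 (rk0 k)).
  by apply: addr_ge0 => //; exact: ltW.
rewrite (_ : _ * _ = r * rho ^+ k); last by rewrite -qh /q; ring.
by move=> /le_trans; apply; rewrite ler_wpM2l// ltW// (lt_trans q0).
Qed.

End UpperLimit.

(** * Lower bound for scaled boxes *)

Lemma sum_half_divn (R : realType) (B N : nat) : (0 < B)%N ->
  \sum_(n < N) (2^-1 : R) ^+ (n %/ B) <= 2 * B%:R.
Proof.
move=> B0.
(* The subtracted term is the rest of the series: the exponent [N %/ B] has still to occur
   [B - N %% B] times, and every later one [B] times. *)
suff -> : \sum_(n < N) (2^-1 : R) ^+ (n %/ B) =
    2 * B%:R - (2 * B%:R - (N %% B)%:R) * (2^-1) ^+ (N %/ B).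
  rewrite gerBl mulr_ge0 ?exprn_ge0// subr_ge0 -natrM ler_nat.
  by rewrite (leq_trans (ltnW (ltn_pmod N B0)))// leq_pmull.
elim: N => [|N ih]; first by rewrite big_ord0 mod0n div0n expr0; ring.
rewrite big_ord_recr/= ih modnS divnS//; case: ifPn => h; last first.
  by rewrite add0n -natr1; ring.
have -> : (N %% B)%:R = B%:R - 1 :> R.
  have dvd : (B %| (N %% B).+1)%N.
    by move: h; rewrite {1}(divn_eq N B) -addnS dvdn_addr ?dvdn_mull.
  have -> : B%:R = (N %% B).+1%:R :> R.
    by congr (_%:R); apply/eqP; rewrite eqn_leq dvdn_leq// ltn_pmod.
  by rewrite -natr1 addrK.
by rewrite add1n exprS /=; field.
Qed.

Section LowerLimit.
Context (R : realType) (d : nat) (dT : measure_display) (T : measurableType dT).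
Variables (P : probability T R) (pts : T -> set (spt R d)) (c : R).
Hypothesis hpp : poisson_pp P pts.
Hypothesis hc : {ae P, forall w,
  (fun n : nat => ((n%:R)^-1)%:E * Hcount (pts w) (@ptzero R d)
                    (ptscale n%:R (@ptone R d)) n%:R)%E @ \oo --> c%:E}.

Lemma admissible_cube (s : R) : 0 < s -> admissible (@diag R d 0) (diag s).
Proof. by move=> s0; split=> // l. Qed.

(** Monotonicity is not visible in the sums defining [chain_prob]; it is read off from two nested
    cubes of these volumes. *)
Lemma chain_prob_le_size (s t : R) m : 0 < s -> s <= t ->
  chain_prob d (s ^+ d.+1) m <= chain_prob d (t ^+ d.+1) m.
Proof.
move=> s0 st; have t0 := lt_le_trans s0 st.
rewrite -lee_fin -[s]subr0 -[t]subr0 -!vol_diag.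
have [ms <- _] := chain_eventP hpp m (admissible_cube s0).
have [mt <- _] := chain_eventP hpp m (admissible_cube t0).
by apply: le_measure; rewrite ?inE// => w; apply: chain_sub => // l.
Qed.

Lemma chain_sum (X : set (spt R d)) (f : nat -> pt R d.+1) (n : nat -> nat) j :
  (forall i, ptle (f i) (f i.+1)) ->
  (forall i, (i < j)%N -> chain X (f i) (f i.+1) (n i)) ->
  chain X (f 0) (f j) (\sum_(i < j) n i).
Proof.
move=> hf; elim: j => [|j ih] h; first by rewrite big_ord0; exact: chain0.
rewrite big_ord_recr/=; apply: (chain_cat (b := f j)) => //; last exact: h.
  by elim: j {ih h} => [//|j ih] l; exact: le_trans (ih l) (hf j l).
by apply: ih => i ij; apply: h; exact: ltnW.
Qed.

(** At least a fraction [1 / A] of the [j] blocks fails to have a chain of length [m], written as a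
    union over sets [B] of failing blocks to suit the union bound. *)
Definition bad_blocks (f : nat -> pt R d.+1) (j m A : nat) : set T :=
  [set w | exists2 B : {set 'I_j}, (j <= A * #|B|)%N &
    split_event (fun i : 'I_j => chain_event pts (f i) (f i.+1) m) finset.set0 B w].

Lemma chain_of_good_blocks f j m A w : (forall i, ptle (f i) (f i.+1)) ->
  ~ bad_blocks f j m A w ->
  exists2 g, chain (pts w) (f 0) (f j) (g * m) & (A * j <= A * g + j)%N.
Proof.
move=> hf nbad; pose B := [set i : 'I_j | ~~ `[< chain (pts w) (f i) (f i.+1) m >]]%SET.
exists #|~: B|.
  (* Failing blocks contribute the empty chain, so the concatenation over all blocks always
     exists. *)
  have := @chain_sum (pts w) f (fun i => if `[< chain (pts w) (f i) (f i.+1) m >]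
    then m else 0) j hf.
  move=> /(_ _)/wrap[i _|]; first by case: ifPn => [/asboolP//|_]; exact: chain0.
  rewrite -big_mkcond/= sum_nat_const; congr (chain _ _ _ (_ * _)).
  by apply: eq_card => i; rewrite !inE negbK.
have hB : (A * #|B| < j)%N.
  rewrite ltnNge; apply/negP => jB; apply: nbad; exists B => //; split=> i; rewrite inE//.
  by move=> /asboolPn.
by have := cardsC B; rewrite card_ord; nia.
Qed.

(** By independence each of the [2 ^ j] sets [B] contributes at most [(4^-1) ^+ (A * #|B|)], which
    is at most [(4^-1) ^+ j]. *)
Lemma prob_bad_blocks f j m A V :
  (forall i, ptle (f i) (f i.+1)) ->
  (forall i, (i < j)%N -> admissible (f i) (f i.+1) /\ vol (f i) (f i.+1) = V) ->
  1 - chain_prob d V m <= (4^-1) ^+ A ->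
  measurable (bad_blocks f j m A) /\
  (P (bad_blocks f j m A) <= ((2^-1) ^+ j)%:E)%E.
Proof.
move=> hf adm hp.
have adm' (i : 'I_j) : admissible (f i) (f i.+1) by have [] := adm i (ltn_ord i).
have dis : disjoint_boxes (fun i : 'I_j => f i) (fun i : 'I_j => f i.+1).
  by move=> i i' ii; apply: (disjoint_steps hf) => /val_inj.
have mS (B : {set 'I_j}) : measurable (split_event
    (fun i : 'I_j => chain_event pts (f i) (f i.+1) m) finset.set0 B).
  apply: measurable_split_event => i.
  by have [] := chain_eventP hpp m (adm' i).
split; first exact: measurable_ex_fin.
apply: (le_trans (union_bound_fin P (fun B _ => mS B))).
apply: (@le_trans _ _ (\sum_(B : {set 'I_j}) ((4^-1) ^+ j)%:E)); last first.
  rewrite sumEFin lee_fin sumr_const -cardsT -powersetT card_powerset cardsT card_ord.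
  rewrite -[leLHS]mulr_natl natrX -exprMn (_ : 2 * 4^-1 = 2^-1 :> R)//.
  by field.
rewrite [leLHS]big_mkcond/=; apply: lee_sum => B _.
case: ifPn => [jB|_]; last by rewrite lee_fin exprn_ge0.
rewrite (prob_chains_split hpp)//; last by move=> i; rewrite inE.
rewrite big_set0 mul1r lee_fin.
apply: (@le_trans _ _ (\prod_(i in B) (4^-1) ^+ A)).
  apply: ler_prod => i _; have [_ ->] := adm i (ltn_ord i); rewrite hp andbT.
  have := chain_prob_itv hpp m (adm' i); have [_ ->] := adm i (ltn_ord i).
  by rewrite subr_ge0 => /andP[].
rewrite prodr_const -exprM ler_wiXn2l// ?invr_ge0//.
by rewrite invf_le1// ler1n.
Qed.

(* The box n(a,b] is cut along its diagonal into [n %/ B] blocks of a fixed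
   size, each of which has a chain of nearly the expected length except with
   probability at most [4^-A]; all but a fraction 1/A of the blocks are good
   outside an event of probability at most [2^-(n %/ B)]. *)
Lemma ae_chain_lower (a b : pt R d.+1) (v r : R) :
  admissible a b -> 0 < v -> v ^+ d.+1 = vol a b -> r < c * v ->
  {ae P, forall w, exists N : nat, forall n, (N <= n)%N -> exists2 m,
     chain (pts w) (ptscale n%:R a) (ptscale n%:R b) m & r * n%:R <= m%:R}.
Proof.
move=> [ab amax] v0 vE rcv.
have [r0|r0] := lerP r 0.
  apply: aeW => w; exists 0%N => n _; exists 0%N; first exact: chain0.
  by rewrite mulr_le0_ge0.
(* There are four losses of size [tau] each: [c - dl] in place of [c], the rounding in [mm], the
   failing blocks (through [g <= A%:R * tau]), and the remainder of [n] modulo [B]. *)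
pose g := c * v; pose tau := (g - r) / 4.
have tau0 : 0 < tau by rewrite divr_gt0// subr_gt0.
have rE : r = g - 4 * tau by rewrite /tau; field.
have g0 : 0 < g by rewrite (lt_trans r0).
pose dl := tau / v.
have dl0 : 0 < dl by rewrite divr_gt0.
have dlv : dl * v = tau by rewrite divfK// gt_eqF.
pose A := (Num.truncn (g / tau)).+1.
have gA : g <= A%:R * tau by rewrite -ler_pdivrMr// ltW// truncnS_gt.
pose mm (B : nat) := Num.truncn ((c - dl) * (v * B%:R)).
(* The index is shifted by one so that the block size is positive. *)
pose E B := ~` chain_event pts (diag 0) (diag (v * B.+1%:R)) (mm B.+1).
have vB0 B : 0 < v * B.+1%:R by rewrite mulr_gt0// ltr0n.
have mE B : measurable (E B).
  by apply: measurableC; have [] := chain_eventP hpp (mm B.+1) (admissible_cube (vB0 B)).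
have p0 : 0 < (4^-1) ^+ A :> R by rewrite exprn_gt0// invr_gt0.
have : {ae P, forall w, exists N, forall B, (N <= B)%N -> ~ E B w}.
  apply: filterS hc => w /cube_limit[_ _ lo]; have [S hS] := lo _ dl0.
  exists (Num.truncn (S / v)).+1 => B SB; apply: contrapT => /contrapT; apply.
  have [|m ch hm] := hS (v * B.+1%:R).
    rewrite mulrC -ler_pdivrMr// ltW// (lt_le_trans (truncnS_gt _))// ler_nat.
    exact: leqW.
  apply: chain_leq ch; rewrite /mm truncn_le_nat (le_lt_trans hm)//.
  by rewrite ltr_nat.
move=> /(ae_eventually_not_small p0 mE) [B0 _ hB0].
pose B := (maxn B0 (Num.truncn tau^-1)).+1.
have PB : 1 - chain_prob d ((v * B%:R) ^+ d.+1) (mm B) <= (4^-1) ^+ A.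
  have [mC PC _] := chain_eventP hpp (mm B) (admissible_cube (vB0 B.-1)).
  have := hB0 B.-1 (leq_maxl _ _); rewrite /E probability_setC//.
  by rewrite PC vol_diag subr0 lee_fin.
have Btau : 1 <= tau * B%:R.
  rewrite mulrC -ler_pdivrMr// mul1r ltW// (lt_le_trans (truncnS_gt _))// ler_nat.
  by rewrite ltnS leq_maxr.
have mB : (g - 2 * tau) * B%:R <= (mm B)%:R.
  have : (c - dl) * (v * B%:R) < (mm B).+1%:R by exact: truncnS_gt.
  rewrite -natr1 (_ : (c - dl) * _ = (g - tau) * B%:R); last by rewrite -dlv /g; ring.
  by lra.
have B1 : (0 < B)%N by [].
pose f n i : pt R d.+1 := fun l =>
  n%:R * (a l + (b l - a l) * (i%:R / (n %/ B)%:R)).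
have ba l : 0 < b l - a l by rewrite subr_gt0.
have ff n i : ptle (f n i) (f n i.+1).
  move=> l; rewrite /f ler_wpM2l// lerD2l ler_wpM2l ?(ltW (ba l))//.
  by rewrite ler_wpM2r ?invr_ge0// ler_nat.
pose V n := (v * (n%:R / (n %/ B)%:R)) ^+ d.+1.
have steps n i : (i < n %/ B)%N ->
    admissible (f n i) (f n i.+1) /\ vol (f n i) (f n i.+1) = V n.
  move=> ij; have j0 : 0 < (n %/ B)%:R :> R by rewrite ltr0n (leq_trans _ ij).
  have n0 : 0 < n%:R :> R.
    by rewrite ltr0n; apply: contraLR ij; rewrite -!leqNgt leqn0 => /eqP ->; rewrite div0n.
  split; last first.
    rewrite /V exprMn vE -[X in _ ^+ X](card_ord d.+1) -prodr_const -big_split/=.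
    by apply: eq_bigr => l _; rewrite /f -natr1; ring.
  split=> [l|]; last first.
    rewrite /f mulr_ge0// addr_ge0// mulr_ge0 ?(ltW (ba _))// divr_ge0//.
  rewrite /f ltr_pM2l// ltrD2l ltr_pM2l// ltr_pM2r ?invr_gt0//.
  by rewrite ltr_nat.
(* Cutting into [n %/ B] pieces makes each block at least as large in volume as the cube of side
   [v * B%:R], and a larger volume only helps. *)
have tail n : (0 < n %/ B)%N -> 1 - chain_prob d (V n) (mm B) <= (4^-1) ^+ A.
  move=> j0; apply: le_trans PB; rewrite lerD2l lerN2 /V.
  apply: chain_prob_le_size; first exact: (vB0 B.-1).
  rewrite ler_pM2l// ler_pdivlMr ?ltr0n//.
  by rewrite -natrM ler_nat mulnC leq_divM.
pose bad n := if (0 < n %/ B)%N then bad_blocks (f n) (n %/ B) (mm B) A else set0.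
have mbad n : measurable (bad n).
  by rewrite /bad; case: ifPn => // /tail h; have [] := prob_bad_blocks (ff n) (steps n) h.
have Pbad n : (P (bad n) <= ((2^-1) ^+ (n %/ B))%:E)%E.
  rewrite /bad; case: ifPn => [/tail h|_].
    by have [] := prob_bad_blocks (ff n) (steps n) h.
  by rewrite measure0 lee_fin exprn_ge0.
have := borel_cantelli mbad Pbad (fun N => sum_half_divn R N B1).
apply: filterS => w [N hN].
exists (maxn N (maxn B (Num.truncn (g * B%:R / tau)).+1)) => n.
rewrite !geq_max => /and3P[Nn Bn gn].
have j0 : (0 < n %/ B)%N by rewrite divn_gt0.
have := hN n Nn; rewrite /bad j0 => /(chain_of_good_blocks (ff n))[gd ch hgd].
have jR : (n %/ B)%:R != 0 :> R by rewrite pnatr_eq0 -lt0n.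
exists (gd * mm B)%N.
  rewrite (_ : ptscale n%:R a = f n 0%N); last first.
    by apply/funext => l; rewrite /f /ptscale mul0r mulr0 addr0.
  rewrite (_ : ptscale n%:R b = f n (n %/ B)%N)//.
  by apply/funext => l; rewrite /f /ptscale divff// mulr1 subrKC.
have gn' : g * B%:R <= tau * n%:R.
  rewrite [leRHS]mulrC -(ler_pdivrMr _ _ tau0) ltW//.
  by rewrite (lt_le_trans (truncnS_gt _))// ler_nat.
have hgd' : A%:R * (n %/ B)%:R <= A%:R * gd%:R + (n %/ B)%:R :> R.
  by rewrite -!natrM -natrD ler_nat.
have nj : n%:R - B%:R <= (n %/ B)%:R * B%:R :> R.
  rewrite lerBlDr -natrM -natrD ler_nat {1}(divn_eq n B) leq_add2l.
  by rewrite ltnW// ltn_pmod.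
have A0 : 0 < A%:R :> R by rewrite ltr0n.
have B0R : 0 < B%:R :> R by rewrite ltr0n.
have j0R : 0 <= (n %/ B)%:R :> R by [].
have gd0R : 0 <= gd%:R :> R by [].
rewrite natrM.
move: (A%:R : R) (B%:R : R) (n%:R : R) ((n %/ B)%:R : R) (gd%:R : R) ((mm B)%:R : R)
  gA mB gn' hgd' nj A0 B0R j0R gd0R => A' B' n' j' gd' m' gA mB gn' hgd' nj A0 B0R j0R gd0R.
have g2 : 0 < g - 2 * tau by lra.
have s1 : (g - 3 * tau) * j' <= gd' * (g - 2 * tau).
  have s2 : j' * g <= j' * (A' * tau) by rewrite ler_wpM2l.
  have s3 : 0 <= j' * tau by rewrite mulr_ge0// ltW.
  rewrite -(ler_pM2l A0); have := ler_wpM2r (ltW g2) hgd'; lra.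
have s4 : gd' * ((g - 2 * tau) * B') <= gd' * m' by rewrite ler_wpM2l.
have s5 := ler_wpM2r (ltW B0R) s1.
have g3 : 0 <= g - 3 * tau by lra.
have s6 := ler_wpM2l g3 nj.
have s7 : 0 <= tau * B' by rewrite mulr_ge0 ?ltW.
by rewrite rE; lra.
Qed.

End LowerLimit.

(** * Chains from base points far away *)

Lemma expn_le_fact_expR (R : realType) (m : nat) : (0 < m)%N ->
  m%:R ^+ m <= m`!%:R * expR 1 ^+ m :> R.
Proof.
case: m => // m _; rewrite -expRM_natl mulr1 mulrC -ler_pdivrMr ?ltr0n ?fact_gt0//.
by apply: le_trans (expR_ge1Dxn m (ler0n R m.+1)); rewrite lerDr.
Qed.

(** The factorial of [m] is at least [(m / e) ^ m], so the quotient is at most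
    [(V * e ^ D / m ^ D) ^ m]. The hypothesis bounds this by [e ^ (- D * m)], and [e >= 2]. *)
Lemma pow_div_fact_le (R : realType) (D m : nat) (V : R) :
  (0 < D)%N -> (0 < m)%N -> 0 <= V -> V * (expR 1 ^+ 2) ^+ D <= m%:R ^+ D ->
  V ^+ m / m`!%:R ^+ D <= 2^-1 ^+ m.
Proof.
move=> D0 m0 V0 hV; set ee := expR 1 : R.
have ee2 : 2 <= ee by have := expR_ge1Dx (1 : R); rewrite -[1 + 1]/(2 : R).
have ee0 : 0 < ee by rewrite expR_gt0.
have f0 : 0 < m`!%:R :> R by rewrite ltr0n fact_gt0.
rewrite exprVn ler_pdivrMr ?exprn_gt0// mulrC ler_pdivlMr ?exprn_gt0//.
apply: (@le_trans _ _ ((V * ee ^+ D) ^+ m)).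
  rewrite exprMn ler_wpM2l ?exprn_ge0// lerXn2r ?nnegrE ?exprn_ge0// ?(ltW ee0)//.
  apply: (le_trans ee2); rewrite -[leLHS]expr1 ler_weXn2l//.
  by apply: le_trans ee2; rewrite ler1n.
apply: (@le_trans _ _ (((m%:R / ee) ^+ D) ^+ m)).
  rewrite lerXn2r ?nnegrE ?mulr_ge0 ?exprn_ge0 ?divr_ge0// ?(ltW ee0)//.
  rewrite expr_div_n ler_pdivlMr ?exprn_gt0//; apply: le_trans hV.
  by rewrite -mulrA -exprMn -expr2.
rewrite exprAC lerXn2r ?nnegrE ?exprn_ge0 ?divr_ge0// ?(ltW ee0)// ?(ltW f0)//.
by rewrite expr_div_n ler_pdivrMr ?exprn_gt0//; exact: expn_le_fact_expR.
Qed.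

Lemma sum_succ_half (R : realType) (N : nat) :
  \sum_(l < N) l.+1%:R * (2^-1 : R) ^+ l <= 4.
Proof.
suff -> : \sum_(l < N) l.+1%:R * (2^-1 : R) ^+ l = 4 - (2 * N%:R + 4) * 2^-1 ^+ N.
  by rewrite gerBl mulr_ge0 ?exprn_ge0// addr_ge0// mulr_ge0.
elim: N => [|N ih]; first by rewrite big_ord0 expr0; ring.
by rewrite big_ord_recr/= ih exprS -natr1; field.
Qed.

Section Norm.
Variables (R : realType) (d : nat).

Lemma normi_ge (y : pt R d) i : `|y i| <= normi y.
Proof. exact: (le_bigmax_cond _ (fun i => `|y i|)). Qed.

Lemma normi_ge0 (y : pt R d) : 0 <= normi y.
Proof. by rewrite /normi; elim/big_ind : _ => // u v u0 v0; rewrite le_max u0. Qed.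

Lemma join_time_scale (s t : R) (y : pt R d) :
  ptscale s (join_time y t) = join_time (ptscale s y) (s * t).
Proof. by apply/funext => l; rewrite /ptscale /join_time; case: unlift. Qed.

End Norm.

Section FarBound.
Context (R : realType) (d : nat) (dT : measure_display) (T : measurableType dT).
Variables (P : probability T R) (pts : T -> set (spt R d)).
Hypothesis hpp : poisson_pp P pts.

Lemma Hcount_le (X : set (spt R d)) (y x : pt R d) (t r : R) :
  (forall m, chain X (join_time y 0) (join_time x t) m -> m%:R <= r) ->
  (Hcount X y x t <= r%:E)%E.
Proof.
by move=> h; rewrite HcountE; apply: ge_ereal_sup => _ [m /h mr <-]; rewrite lee_fin.
Qed.

Lemma Hcount_ge (X : set (spt R d)) (y x : pt R d) (t r : R) (m : nat) :
  chain X (join_time y 0) (join_time x t) m -> r <= m%:R ->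
  (r%:E <= Hcount X y x t)%E.
Proof.
move=> ch rm; apply: (@le_trans _ _ (m%:R)%:E); first by rewrite lee_fin.
by rewrite HcountE; apply: ereal_sup_ubound; exists m.
Qed.

(* The base points y with norm in [(i-1)^(d+1), i^(d+1)) are handled together:
   this choice makes the threshold of order norm^(d/(d+1)) a multiple of i^d. *)
Lemma ae_Hcount_far (x : pt R d) (t : R) : (0 < d)%N -> 0 < t ->
  exists2 C : R, 0 < C & {ae P, forall w, exists N : nat, forall n y,
    (N <= n)%N -> ptle y x -> 1 <= normi y ->
    (Hcount (pts w) (ptscale n%:R y) (ptscale n%:R x) (n%:R * t) <=
      (C * n%:R * normi y `^ dexp R d)%:E)%E}.
Proof.
move=> d0 t0.
pose K := normi x + 1.
have K1 : 1 <= K by rewrite lerDr normi_ge0.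
have K0 : 0 < K by rewrite (lt_le_trans _ K1).
(* [Q] collects the constants of [volle], so that the length [A * n.+1 * i ^ d] with [A] above [Q]
   meets the condition of [pow_div_fact_le]. *)
pose Q := expR 1 ^+ 2 * (t + 1) * (2 * K) : R.
pose A := (Num.truncn Q).+1.
have QA : Q <= A%:R by rewrite ltW// truncnS_gt.
have Q0 : 0 <= Q.
  apply: mulr_ge0; last by rewrite mulr_ge0// ltW.
  by apply: mulr_ge0; [rewrite exprn_ge0// expR_ge0|rewrite addr_ge0// ltW].
(* For [i > 0] this corner lies below every [y] with [normi y < i%:R ^+ d.+1], and its spatial part
   lies strictly below [x]. *)
pose lo (i : nat) : pt R d.+1 := join_time (fun=> - (K * i%:R ^+ d.+1)) 0.
pose hi : pt R d.+1 := join_time x t.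
have xK l : `|x l| <= K by rewrite (le_trans (normi_ge x l))// lerDl.
have i1D i : (0 < i)%N -> 1 <= i%:R ^+ d.+1 :> R.
  by move=> i0; rewrite exprn_ege1// ler1n.
have lohi i : (0 < i)%N -> ptlt (lo i) hi.
  move=> i0; apply/ptlt_join_time; split=> // l.
  have : - `|x l| <= x l by rewrite lerNl -normrN ler_norm.
  apply: lt_le_trans; rewrite ltrN2.
  apply: (@lt_le_trans _ _ K); first by rewrite (le_lt_trans (normi_ge x l))// ltrDl.
  by rewrite ler_peMr ?i1D// ltW.
have adm n i : (0 < i)%N -> admissible (ptscale n.+1%:R (lo i)) (ptscale n.+1%:R hi).
  move=> i0; split=> [l|]; first by rewrite /ptscale ltr_pM2l ?ltr0n// lohi.
  by rewrite /ptscale /lo join_time_max mulr0.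
pose m n i := (A * n.+1 * i ^ d)%N.
have volle n i : (0 < i)%N ->
    vol (ptscale n.+1%:R (lo i)) (ptscale n.+1%:R hi) * (expR 1 ^+ 2) ^+ d.+1 <=
    (m n i)%:R ^+ d.+1.
  move=> i0; rewrite vol_ptscale vol_join_time subr0.
  have pr : \prod_i0 (x i0 - - (K * i%:R ^+ d.+1)) <= (2 * K * i%:R ^+ d.+1) ^+ d.
    rewrite -[X in _ <= _ ^+ X](card_ord d) -prodr_const; apply: ler_prod => l _.
    have := xK l; rewrite ler_norml opprK => /andP[x1 x2].
    have KK : K <= K * i%:R ^+ d.+1 by rewrite ler_peMr ?i1D// ltW.
    by apply/andP; split; lra.
  have E0 : 0 <= (expR 1 ^+ 2) ^+ d.+1 :> R by rewrite !exprn_ge0 ?expR_ge0.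
  apply: (@le_trans _ _ (n.+1%:R ^+ d.+1 * ((2 * K * i%:R ^+ d.+1) ^+ d * t) *
     (expR 1 ^+ 2) ^+ d.+1)).
    by rewrite ler_wpM2r// ler_wpM2l ?exprn_ge0// ler_wpM2r// ltW.
  have -> : (m n i)%:R ^+ d.+1 =
      A%:R ^+ d.+1 * n.+1%:R ^+ d.+1 * (i%:R ^+ d) ^+ d.+1 :> R.
    by rewrite /m 2!natrM natrX 2!exprMn.
  apply: (@le_trans _ _ (Q ^+ d.+1 * n.+1%:R ^+ d.+1 * (i%:R ^+ d) ^+ d.+1)); last first.
    by rewrite ler_wpM2r ?exprn_ge0// ler_wpM2r ?exprn_ge0// lerXn2r ?nnegrE.
  have kt : (2 * K) ^+ d * t <= (2 * K) ^+ d.+1 * (t + 1) ^+ d.+1.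
    have t1 : 1 <= t + 1 by rewrite lerDr ltW.
    apply: ler_pM; rewrite ?exprn_ge0 ?mulr_ge0 ?(ltW K0) ?(ltW t0)//.
      by rewrite ler_weXn2l//; nra.
    by rewrite (le_trans (_ : t <= t + 1)) ?lerDl// -[leLHS]expr1 ler_weXn2l.
  rewrite /Q; move: kt E0; set E := expR 1 ^+ 2 : R; set k2 := 2 * K => kt E0.
  set u := (i%:R ^+ d) ^+ d.+1.
  have -> : n.+1%:R ^+ d.+1 * ((k2 * i%:R ^+ d.+1) ^+ d * t) * E ^+ d.+1 =
      (E ^+ d.+1 * n.+1%:R ^+ d.+1 * u) * (k2 ^+ d * t).
    by rewrite (exprMn _ k2) -(exprAC _ d) -/u; move: (u) (k2 ^+ d) => u' k'; ring.
  have -> : (E * (t + 1) * k2) ^+ d.+1 * n.+1%:R ^+ d.+1 * u =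
      (E ^+ d.+1 * n.+1%:R ^+ d.+1 * u) * (k2 ^+ d.+1 * (t + 1) ^+ d.+1).
    rewrite 2!exprMn; move: (u) (k2 ^+ d.+1) (E ^+ d.+1) ((t + 1) ^+ d.+1) => u' k' E' t'.
    by ring.
  by apply: ler_wpM2l => //; rewrite !mulr_ge0// !exprn_ge0.
pose ev n i := chain_event pts (ptscale n.+1%:R (lo i)) (ptscale n.+1%:R hi) (m n i).
have mev n i : measurable (ev n i.+1).
  by have [] := chain_eventP hpp (m n i.+1) (adm n _ (ltn0Sn i)).
have Aid i : (0 < i)%N -> (i <= i ^ d)%N.
  by move=> i0; rewrite -[X in (X <= _)%N]expn1 leq_pexp2l.
have Pev n i : (P (ev n i.+1) <= (2^-1 ^+ (n + i))%:E)%E.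
  have ai := adm n _ (ltn0Sn i).
  have [_ -> _] := chain_eventP hpp (m n i.+1) ai.
  rewrite lee_fin; apply: le_trans (chain_prob_le hpp (m n i.+1) ai) _.
  have V0 : 0 <= vol (ptscale n.+1%:R (lo i.+1)) (ptscale n.+1%:R hi).
    by apply: prodr_ge0 => l _; rewrite subr_ge0 ltW//; case: ai.
  have mni : (n + i < m n i.+1)%N.
    apply: (@leq_trans (1 * n.+1 * i.+1)%N); first by nia.
    by rewrite /m !leq_mul// Aid.
  apply: (@le_trans _ _ (2^-1 ^+ m n i.+1)).
    by apply: pow_div_fact_le => //; [exact: leq_ltn_trans mni|exact: volle].
  rewrite ler_wiXn2l ?invr_ge0// ?invf_le1 ?ler1n// ltnW//.
(* Borel-Cantelli needs a single index: the [l.+1] pairs of a scale [n.+1] and a shell [i.+1] with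
   [n + i = l] are grouped, each of probability at most [2^-1 ^+ l]. *)
pose G l := [set w | exists2 n : 'I_l.+1, true & ev n (l - n).+1 w].
have mG l : measurable (G l) by apply: measurable_ex_fin => n _.
have PG l : (P (G l) <= (l.+1%:R * 2^-1 ^+ l)%:E)%E.
  apply: (le_trans (union_bound_fin P (fun (n : 'I_l.+1) _ => mev n (l - n)%N))).
  apply: (@le_trans _ _ (\sum_(n < l.+1) (2^-1 ^+ l)%:E)).
    apply: lee_sum => n _; apply: le_trans (Pev _ _) _.
    by rewrite subnKC// -ltnS.
  by rewrite sumEFin sumr_const card_ord mulr_natl.
(* The factor [2 ^ d] passes from the outer to the inner radius of a shell, by
   [i.+2 ^ d <= 2 ^ d * i.+1 ^ d]. *)
exists (A * 2 ^ d)%:R; first by rewrite ltr0n muln_gt0 expn_gt0.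
have := borel_cantelli mG PG (@sum_succ_half R).
apply: filterS => w [L hL]; exists L.+1 => -[//|n] y Ln yx y1.
have ex : exists i, normi y < i%:R ^+ d.+1.
  exists (Num.truncn (normi y)).+1; apply: lt_le_trans (truncnS_gt _) _.
  by rewrite -natrX ler_nat -[X in (X <= _)%N]expn1 leq_pexp2l.
case: (ex_minnP ex) => -[|[|i]] yi min_i.
- by move: yi; rewrite expr0n ltNge normi_ge0.
- by move: yi; rewrite expr1n ltNge y1.
have iy : i.+1%:R ^+ d.+1 <= normi y.
  by rewrite leNgt; apply/negP => /min_i; rewrite ltnn.
apply: Hcount_le => k ch.
have {}ch : chain (pts w) (ptscale n.+1%:R (lo i.+2)) (ptscale n.+1%:R hi) k.
  apply: chain_sub ch; rewrite join_time_scale; apply/ptle_join_time; split=> //.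
    move=> l; rewrite /ptscale ler_wpM2l//.
    have : - `|y l| <= y l by rewrite lerNl -normrN ler_norm.
    apply: le_trans; rewrite lerN2 (le_trans (normi_ge y l))//.
    by rewrite (le_trans (ltW yi))// ler_peMl// exprn_ge0.
have km : (k < m n i.+2)%N.
  rewrite ltnNge; apply/negP => mk; apply: (hL (n + i.+1)%N).
    by apply: leq_trans (leq_addr _ _); rewrite -ltnS.
  have nl : (n < (n + i.+1).+1)%N by rewrite ltnS leq_addr.
  by exists (Ordinal nl) => //=; rewrite addKn; exact: chain_leq ch.
apply: (@le_trans _ _ (m n i.+2)%:R); first by rewrite ler_nat ltnW.
apply: (@le_trans _ _ ((A * 2 ^ d)%:R * n.+1%:R * i.+1%:R ^+ d)).
  rewrite -natrX -!natrM ler_nat /m.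
  have : (i.+2 ^ d <= 2 ^ d * i.+1 ^ d)%N by rewrite -expnMn leq_exp2r//; lia.
  by move=> h; rewrite (mulnAC A (2 ^ d)%N) -[X in (_ <= X)%N]mulnA leq_mul2l h orbT.
rewrite ler_wpM2l ?mulr_ge0//.
have -> : i.+1%:R ^+ d = (i.+1%:R ^+ d.+1) `^ dexp R d :> R.
  rewrite -!powR_mulrn// -powRrM /dexp; congr (_ `^ _).
  by rewrite mulrC divfK// pnatr_eq0.
by rewrite ge0_ler_powR// ?nnegrE ?exprn_ge0 ?normi_ge0// /dexp divr_ge0.
Qed.

End FarBound.

(** * Convergence tested at countably many rational levels, and almost sure events on a product *)

Lemma cvge_rat_bounds (R : realType) (f : nat -> \bar R) (l : \bar R) :
  (forall q : rat, ((ratr q)%:E < l)%E ->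
     \forall n \near \oo, ((ratr q)%:E <= f n)%E) ->
  (forall q : rat, (l < (ratr q)%:E)%E ->
     \forall n \near \oo, (f n <= (ratr q)%:E)%E) ->
  f n @[n --> \oo] --> l.
Proof.
case: l => [l||] lo up.
- have key e : 0 < e -> \forall n \near \oo, ((l - e)%:E <= f n <= (l + e)%:E)%E.
    move=> e0.
    have [q1] := rat_in_itvoo (ltac:(by rewrite gtrBl) : l - e < l).
    have [q2] := rat_in_itvoo (ltac:(by rewrite ltrDl) : l < l + e).
    rewrite !in_itv/= => /andP[q2l q2e] /andP[q1e q1l].
    have {}lo := lo q1 q1l; have {}up := up q2 q2l.
    near=> n; apply/andP; split.
      by apply: (@le_trans _ _ (ratr q1)%:E); [rewrite lee_fin ltW|near: n].
    by apply: (@le_trans _ _ (ratr q2)%:E); [near: n|rewrite lee_fin ltW].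
  have aux (z : \bar R) e : ((l - e)%:E <= z <= (l + e)%:E)%E ->
      z \is a fin_num /\ `|l - fine z| <= e.
    case: z => [r| |]; rewrite ?leye_eq ?leeNy_eq ?andbF// !lee_fin => /andP[? ?].
    by split=> //=; rewrite ler_norml; apply/andP; split; lra.
  apply/fine_cvgP; split; first by apply: filterS (key 1 ltr01) => n /aux[].
  by apply/cvgrPdist_le => e e0; apply: filterS (key e e0) => n /aux[].
- apply/cvgeyPge => A; have [q] := rat_in_itvoo (ltac:(by rewrite ltrDl) : A < A + 1).
  rewrite in_itv/= => /andP[Aq _]; apply: filterS (lo q (ltry _)) => n.
  by apply: le_trans; rewrite lee_fin ltW.
- apply/cvgeNyPle => A; have [q] := rat_in_itvoo (ltac:(by rewrite gtrBl) : A - 1 < A).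
  rewrite in_itv/= => /andP[_ qA]; apply: filterS (up q (ltNyr _)) => n.
  by move=> /le_trans; apply; rewrite lee_fin ltW.
Unshelve. all: by end_near. Qed.

Lemma ae_product (R : realType) (d1 d2 : measure_display)
  (T1 : measurableType d1) (T2 : measurableType d2)
  (P1 : probability T1 R) (P2 : probability T2 R)
  (A1 : T1 -> Prop) (A2 : T2 -> Prop) :
  {ae P1, forall w, A1 w} -> {ae P2, forall w, A2 w} ->
  {ae (P1 \x P2)%E, forall w : T1 * T2, A1 w.1 /\ A2 w.2}.
Proof.
move=> [B1 [m1 z1 s1]] [B2 [m2 z2 s2]].
have n1 : (P1 \x P2)%E.-negligible (B1 `*` setT).
  exists (B1 `*` setT); split=> //; first exact: measurableX.
  by apply: eq_trans (product_measure1E _ _ m1 measurableT) _;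
    rewrite [X in (X * _)%E]z1 mul0e.
have n2 : (P1 \x P2)%E.-negligible (setT `*` B2).
  exists (setT `*` B2); split=> //; first exact: measurableX.
  by apply: eq_trans (product_measure1E _ _ measurableT m2) _;
    rewrite [X in (_ * X)%E]z2 mule0.
apply: negligibleS (negligibleU n1 n2) => -[w1 w2] /= /not_andP[h|h].
  by left; split=> //; exact: s1.
by right; split=> //; exact: s2.
Qed.

(** * The limit profile expressed by box volumes *)

Section Profile.
Variables (R : realType) (d : nat) (c : R) (x : pt R d) (t : R).
Hypothesis t0 : 0 < t.

(** For [y] below [x], this is the side of the cube of dimension [d.+1] with the volume of the box
    between [(y, 0)] and [(x, t)]. *)
Definition eff_size (y : pt R d) : R :=
  (t * \prod_i (x i - y i)) `^ (d.+1%:R)^-1.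

Lemma prod_sub_ge0 y : ptle y x -> 0 <= \prod_i (x i - y i).
Proof. by move=> yx; apply: prodr_ge0 => i _; rewrite subr_ge0. Qed.

Lemma exprn_root (z : R) : 0 <= z -> (z `^ (d.+1%:R)^-1) ^+ d.+1 = z.
Proof.
move=> z0; rewrite -powR_mulrn ?powR_ge0// -powRrM mulVf ?pnatr_eq0//.
by rewrite powRr1.
Qed.

Lemma root_exprn (z : R) : 0 <= z -> (z ^+ d.+1) `^ (d.+1%:R)^-1 = z.
Proof.
by move=> z0; rewrite -powR_mulrn// -powRrM mulfV ?pnatr_eq0// powRr1.
Qed.

Lemma eff_size_vol y : ptle y x ->
  eff_size y ^+ d.+1 = vol (join_time y 0) (join_time x t).
Proof.
move=> yx; rewrite exprn_root; last by rewrite mulr_ge0 ?prod_sub_ge0// ltW.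
by rewrite vol_join_time subr0 mulrC.
Qed.

Lemma eff_size_gt0 y : ptlt y x -> 0 < eff_size y.
Proof.
move=> yx; rewrite powR_gt0// mulr_gt0//; apply: prodr_gt0 => i _.
by rewrite subr_gt0.
Qed.

(** Moved under the root, [t] becomes [t ^ d.+1], of which the spatial scaling cancels [t ^ d]. *)
Lemma gfun_eff_size y : ptle y x ->
  (t%:E * gfun c (ptscale t^-1 (ptsub x y)))%E = (c * eff_size y)%:E.
Proof.
move=> yx; rewrite /gfun; case: ifPn => [_|/negP[]]; last first.
  by apply/forallP => i; rewrite /ptscale /ptsub mulr_ge0 ?invr_ge0 ?subr_ge0// ltW.
rewrite -EFinM mulrCA; congr (_ * _)%:E.
rewrite /ptscale /ptsub big_split/= prodr_const card_ord /eff_size.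
rewrite -{1}(root_exprn (ltW t0)) -powRM ?exprn_ge0 ?(ltW t0)//; last first.
  by rewrite mulr_ge0 ?prod_sub_ge0// exprn_ge0 // invr_ge0 ltW.
congr (_ `^ _); rewrite mulrA; congr (_ * _).
by rewrite exprS -mulrA -exprMn divff ?expr1n ?mulr1// gt_eqF.
Qed.

Lemma ufunE u0 : ufun c u0 x t =
  ereal_sup [set (u0 y + c * eff_size y)%:E | y in [set y | ptle y x]].
Proof.
rewrite /ufun gt_eqF//; congr ereal_sup; apply/seteqP; split=> z /= [y yx <-];
  by exists y => //; rewrite gfun_eff_size.
Qed.

Context (dT : measure_display) (T : measurableType dT).
Variables (P : probability T R) (pts : T -> set (spt R d)).
Hypothesis hpp : poisson_pp P pts.
Hypothesis hc : {ae P, forall w,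
  (fun n : nat => ((n%:R)^-1)%:E * Hcount (pts w) (@ptzero R d)
                    (ptscale n%:R (@ptone R d)) n%:R)%E @ \oo --> c%:E}.

Lemma join_time0_scale (s : R) (y : pt R d) :
  join_time (ptscale s y) 0 = ptscale s (join_time y 0).
Proof. by rewrite join_time_scale mulr0. Qed.

Lemma ae_Hcount_upper y r : ptlt y x -> c * eff_size y < r ->
  {ae P, forall w, exists N : nat, forall n, (N <= n)%N ->
    (Hcount (pts w) (ptscale n%:R y) (ptscale n%:R x) (n%:R * t) <=
     (r * n%:R)%:E)%E}.
Proof.
move=> yx cr; have yx' : ptle y x by move=> i; exact: ltW.
have lt1 : ptlt (join_time y 0) (join_time x t) by apply/ptlt_join_time.
have := ae_chain_upper hpp hc lt1 (join_time_max _ _) (eff_size_gt0 yx)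
  (eff_size_vol yx') cr.
apply: filterS => w [N hN]; exists N => n Nn; apply: Hcount_le => m ch.
by apply: hN Nn _; rewrite -join_time0_scale join_time_scale.
Qed.

Lemma ae_Hcount_lower y r : ptle y x -> r < c * eff_size y ->
  {ae P, forall w, exists N : nat, forall n, (N <= n)%N ->
    ((r * n%:R)%:E <=
     Hcount (pts w) (ptscale n%:R y) (ptscale n%:R x) (n%:R * t))%E}.
Proof.
move=> yx rc; have [yx'|] := pselect (ptlt y x); last first.
  move=> /existsNP[i /negP]; rewrite -leNgt => xy.
  (* A degenerate box has [eff_size] 0, so [r] is negative and the empty chain suffices. *)
  have r0 : r < 0.
    move: rc; rewrite /eff_size (bigD1 i)//=.
    have -> : x i - y i = 0 by apply/eqP; rewrite subr_eq0 eq_le xy yx.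
    by rewrite mul0r mulr0 powR0 ?mulr0// invr_eq0 pnatr_eq0.
  apply: aeW => w; exists 0%N => n _; apply: (Hcount_ge (chain0 _ _ _)).
  by rewrite mulr_le0_ge0// ltW.
have adm : admissible (join_time y 0) (join_time x t).
  by split; [apply/ptlt_join_time|rewrite join_time_max].
have := ae_chain_lower hpp hc adm (eff_size_gt0 yx') (eff_size_vol yx) rc.
apply: filterS => w [N hN]; exists N => n Nn; have [m ch rm] := hN n Nn.
by apply: Hcount_ge rm; rewrite join_time0_scale -join_time_scale.
Qed.

End Profile.

(** * Deterministic comparison on a fixed outcome *)

Section Deterministic.
Variables (R : realType) (d : nat) (c : R) (u0 : pt R d -> R).
Hypotheses (hd : (0 < d)%N) (u0lip : loc_lipschitz u0).
Variables (x : pt R d) (t : R).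
Hypothesis t0 : 0 < t.
Variables (s : nat -> pt R d -> \bar R) (X : set (spt R d)).

Definition rat_pt (z : {ffun 'I_d -> rat}) : pt R d := fun i => ratr (z i).

Lemma normi_lt (y : pt R d) r : 0 < r -> (forall i, `|y i| < r) -> normi y < r.
Proof. by move=> r0 h; apply: bigmax_lt. Qed.

Lemma normi_le (y : pt R d) r : 0 <= r -> (forall i, `|y i| <= r) -> normi y <= r.
Proof. by move=> r0 h; apply: bigmax_le. Qed.

(** The margin [e] makes one pair of rational points bracket a whole neighbourhood of [y], as a
    compactness argument needs; the Lipschitz bound keeps the gap of [u0] small. *)
Lemma rat_bracket (y : pt R d) (h : R) : 0 < h ->
  exists (p q : {ffun 'I_d -> rat}) (e : R),
  [/\ 0 < e, forall i, rat_pt p i < y i - e, forall i, y i + e < rat_pt q i &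
      u0 (rat_pt q) - u0 (rat_pt p) <= h].
Proof.
move=> h0; have [r [L [r0 hL]]] := u0lip y.
(* The first bound keeps both rational points inside the Lipschitz ball; the second handles their
   distance, at most [2 * dl], with [L] replaced by a positive constant. *)
pose dl := Num.min (r / 2) (h / (2 * (`|L| + 1))).
have L1 : 0 < `|L| + 1 by rewrite ltr_wpDl.
have dl0 : 0 < dl by rewrite lt_min !divr_gt0// mulr_gt0.
have dlr : dl < r.
  by rewrite (le_lt_trans (_ : dl <= r / 2)) ?ge_min ?lexx//; lra.
have dlh : (`|L| + 1) * (2 * dl) <= h.
  have : dl <= h / (2 * (`|L| + 1)) by rewrite ge_min lexx orbT.
  by rewrite ler_pdivlMr ?mulr_gt0//; lra.
have /choice[p hp] i : exists q : rat, y i - dl < ratr q < y i - dl / 2.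
  have [|q] := @rat_in_itvoo R (y i - dl) (y i - dl / 2); first by lra.
  by rewrite in_itv; exists q.
have /choice[q hq] i : exists q : rat, y i + dl / 2 < ratr q < y i + dl.
  have [|q] := @rat_in_itvoo R (y i + dl / 2) (y i + dl); first by lra.
  by rewrite in_itv; exists q.
exists (finfun p), (finfun q), (dl / 2); split.
- by rewrite divr_gt0.
- by move=> i; rewrite /rat_pt ffunE; case/andP: (hp i).
- by move=> i; rewrite /rat_pt ffunE; case/andP: (hq i).
have np : normi (ptsub (rat_pt (finfun p)) y) < r.
  apply: normi_lt => // i; rewrite /ptsub /rat_pt ffunE ltr_norml.
  by case/andP: (hp i) => ? ?; apply/andP; split; lra.
have nq : normi (ptsub (rat_pt (finfun q)) y) < r.
  apply: normi_lt => // i; rewrite /ptsub /rat_pt ffunE ltr_norml.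
  by case/andP: (hq i) => ? ?; apply/andP; split; lra.
have npq : normi (ptsub (rat_pt (finfun q)) (rat_pt (finfun p))) <= 2 * dl.
  apply: normi_le => [|i]; first by rewrite mulr_ge0// ltW.
  rewrite /ptsub /rat_pt !ffunE ler_norml.
  by case/andP: (hp i) => ? ?; case/andP: (hq i) => ? ?; apply/andP; split; lra.
apply: le_trans dlh; apply: (le_trans (ler_norm _)).
apply: (le_trans (hL _ _ nq np)).
have n0 := normi_ge0 (ptsub (rat_pt (finfun q)) (rat_pt (finfun p))).
apply: (@le_trans _ _ ((`|L| + 1) * normi (ptsub (rat_pt (finfun q)) (rat_pt (finfun p))))).
  by rewrite ler_wpM2r// (le_trans (ler_norm _))// lerDl.
by rewrite ler_wpM2l// ltW.
Qed.

Lemma Hcount_anti (y z : pt R d) (r : R) (b : pt R d) : ptle y z ->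
  (Hcount X z b r <= Hcount X y b r)%E.
Proof.
move=> yz; rewrite !HcountE; apply: ge_ereal_sup => _ [m ch <-].
apply: ereal_sup_ubound; exists m => //; apply: chain_sub ch => //.
exact/ptle_join_time.
Qed.

(** One base point already bounds the supremum from below; [r1] and [r2] are the shares of the
    initial height and of the chain. *)
Lemma sigmat_lower (y : pt R d) (r1 r2 : R) : ptle y x -> r1 < u0 y ->
  (fun n : nat => ((n%:R)^-1)%:E * s n (ptscale n%:R y))%E @ \oo --> (u0 y)%:E ->
  (exists N : nat, forall n, (N <= n)%N ->
    ((r2 * n%:R)%:E <= Hcount X (ptscale n%:R y) (ptscale n%:R x) (n%:R * t))%E) ->
  \forall n \near \oo, ((r1 + r2)%:E <=
    ((n%:R)^-1)%:E * sigmat (s n) X (ptscale n%:R x) (n%:R * t))%E.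
Proof.
move=> yx r1y cvs [N hN].
have h0 : 0 < u0 y - r1 by rewrite subr_gt0.
have [N1 _ hN1] := cvge_fin_near h0 cvs.
near=> n; have n0 : 0 < n%:R :> R by rewrite ltr0n; near: n; exists 1%N.
rewrite lee_pdivlMl// /sigmat gt_eqF ?mulr_gt0//.
apply: (@le_trans _ _ (s n (ptscale n%:R y) +
    Hcount X (ptscale n%:R y) (ptscale n%:R x) (n%:R * t))%E); last first.
  apply: ereal_sup_ubound; exists (ptscale n%:R y) => // i.
  by rewrite /ptscale ler_pM2l.
rewrite -EFinM mulrDr EFinD; apply: leeD.
  have /hN1/andP[+ _] : (N1 <= n)%N by near: n; exists N1.
  by rewrite opprB subrKC lee_pdivlMl.
by rewrite mulrC; apply: hN; near: n; exists N.
Unshelve. all: by end_near. Qed.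

Lemma sigmat_upper (C : R) (r : R) : 0 < C ->
  (forall n, (0 < n)%N -> forall y z, ptle y z -> (s n y <= s n z)%E) ->
  (forall q, (fun n : nat => ((n%:R)^-1)%:E * s n (ptscale n%:R (rat_pt q)))%E @ \oo
     --> (u0 (rat_pt q))%:E) ->
  (exists (M : R) (N : nat), 0 < M /\ (0 < N)%N /\
     forall (n : nat) (y : pt R d), (N <= n)%N -> ptle y x -> M <= normi y ->
       (s n (ptscale n%:R y) <= (- ((C + 1) * n%:R * normi y `^ dexp R d))%:E)%E) ->
  (exists N : nat, forall n y, (N <= n)%N -> ptle y x -> 1 <= normi y ->
    (Hcount X (ptscale n%:R y) (ptscale n%:R x) (n%:R * t) <=
      (C * n%:R * normi y `^ dexp R d)%:E)%E) ->
  (forall q k, ptlt (rat_pt q) x -> exists N : nat, forall n, (N <= n)%N ->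
    (Hcount X (ptscale n%:R (rat_pt q)) (ptscale n%:R x) (n%:R * t) <=
     ((c * eff_size x t (rat_pt q) + k.+1%:R^-1) * n%:R)%:E)%E) ->
  (ufun c u0 x t < r%:E)%E ->
  \forall n \near \oo,
    (((n%:R)^-1)%:E * sigmat (s n) X (ptscale n%:R x) (n%:R * t) <= r%:E)%E.
Proof.
move=> C0 smon cvs [M0 [N0 [M00 [_ far_s]]]] [N1 far_H] near_H.
rewrite (ufunE c x t0); set S := [set _ | _ in _] => Sr.
have Sx : S (u0 x + c * eff_size x t x)%:E by exists x => // i.
have Sfin : ereal_sup S \is a fin_num.
  rewrite fin_numElt (lt_trans Sr (ltry _)) andbT.
  exact: lt_le_trans (ltNyr _) (ereal_sup_ubound Sx).
pose u := fine (ereal_sup S).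
have uE : ereal_sup S = u%:E by rewrite fineK.
have u_ub y : ptle y x -> u0 y + c * eff_size x t y <= u.
  by move=> yx; rewrite -lee_fin -uE; apply: ereal_sup_ubound; exists y.
have ur : u < r by rewrite -lte_fin -uE.
(* One [h] each pays for the convergence of the initial height at [q], for the gap of [u0] between
   [p] and [q], and for the chain bound at [p]. *)
pose h := (r - u) / 3.
have h0 : 0 < h by rewrite divr_gt0// subr_gt0.
have hE : r = u + 3 * h by rewrite /h; field.
(* Beyond norm [z ^+ d.+1] the power [dexp] of the norm is at least [z ^+ d], hence at least
   [- r]. *)
pose z := Num.max 1 `|r|.
have z1 : 1 <= z by rewrite le_max lexx.
pose M := Num.max M0 (z ^+ d.+1).
have zD1 : 1 <= z ^+ d.+1 by rewrite exprn_ege1.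
have M1 : 1 <= M by rewrite le_max zD1 orbT.
have far_r (y : pt R d) : M <= normi y -> - r <= normi y `^ dexp R d.
  move=> My; apply: (@le_trans _ _ ((z ^+ d.+1) `^ dexp R d)); last first.
    rewrite ge0_ler_powR ?nnegrE ?exprn_ge0 ?normi_ge0 ?divr_ge0//.
    - by rewrite (le_trans ler01).
    - by apply: le_trans My; rewrite le_max lexx orbT.
  have -> : (z ^+ d.+1) `^ dexp R d = z ^+ d.
    rewrite -!powR_mulrn ?(le_trans ler01)// -powRrM /dexp; congr (_ `^ _).
    by rewrite mulrC divfK// pnatr_eq0.
  apply: (@le_trans _ _ z); first by rewrite le_max -normrN ler_norm orbT.
  by rewrite -[leLHS]expr1 ler_weXn2l.
(* Points are viewed as row vectors to use the compactness of a product of segments. *)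
pose pt_of (v : 'rV[R]_d) : pt R d := fun i => v ord0 i.
pose K : set 'rV[R]_d := [set v | forall i, `[- M, x i]%classic (v ord0 i)].
have K_compact : compact K.
  apply: (@rV_compact _ _ (fun i => `[- M, x i]%classic)) => i.
  exact: segment_compact.
pose good (n : nat) (v : 'rV[R]_d) := (s n (ptscale n%:R (pt_of v)) +
  Hcount X (ptscale n%:R (pt_of v)) (ptscale n%:R x) (n%:R * t) <=
  (r * n%:R)%:E)%E.
have : \forall n \near \oo, K `<=` good n.
  move/compact_near_coveringP : K_compact; apply => v Kv.
  have [p [q [e [e_gt0 pv vq upq]]]] := rat_bracket (pt_of v) h0.
  (* Chains are counted from the lower point [p], which is strictly below [x] even when [v] lies on
     the boundary; the initial height is taken at [q], which may leave the region below [x]. *)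
  have px : ptlt (rat_pt p) x.
    move=> i; have := Kv i; rewrite /= in_itv/= => /andP[_]; apply: lt_le_trans.
    by apply: lt_trans (pv i) _; rewrite gtrBl.
  pose k := Num.truncn h^-1.
  have kh : k.+1%:R^-1 <= h.
    by rewrite invf_ple ?posrE ?ltr0n// ltW// truncnS_gt.
  have [N2 hN2] := near_H p k px.
  have [N3 _ hN3] := cvge_fin_near h0 (cvs q).
  exists (ball v e, [set n | (maxn 1 (maxn N2 N3) <= n)%N]).
    by split; [exact: nbhsx_ballx|exists (maxn 1 (maxn N2 N3))].
  move=> [v' n] /= [[_ bv]]; rewrite !geq_max => /and3P[n1 n2 n3].
  have n0 : 0 < n%:R :> R by rewrite ltr0n.
  have v'p : ptle (rat_pt p) (pt_of v').
    move=> i; have := bv ord0 i; rewrite /ball/= ltr_norml => /andP[_ b2].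
    by have := pv i; rewrite /pt_of; lra.
  have v'q : ptle (pt_of v') (rat_pt q).
    move=> i; have := bv ord0 i; rewrite /ball/= ltr_norml => /andP[b1 _].
    by have := vq i; rewrite /pt_of; lra.
  have sc (y y' : pt R d) : ptle y y' -> ptle (ptscale n%:R y) (ptscale n%:R y').
    by move=> yy i; rewrite /ptscale ler_pM2l//; exact: yy.
  have hs : (s n (ptscale n%:R (pt_of v')) <= (n%:R * (u0 (rat_pt q) + h))%:E)%E.
    apply: le_trans (smon n n1 _ _ (sc _ _ v'q)) _.
    by have /andP[_] := hN3 n n3; rewrite lee_pdivrMl.
  have hH := le_trans (Hcount_anti (n%:R * t) (ptscale n%:R x) (sc _ _ v'p)) (hN2 n n2).
  apply: (le_trans (leeD hs hH)); rewrite -EFinD lee_fin.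
  have hsum : (u0 (rat_pt q) + h) + (c * eff_size x t (rat_pt p) + k.+1%:R^-1) <= r.
    have := u_ub (rat_pt p) (fun i => ltW (px i)); move: kh upq hE.
    by move: (h) (k.+1%:R^-1) (c * _) (u0 _) (u0 _) => *; lra.
  by rewrite [X in X + _]mulrC -mulrDl ler_pM2r.
move=> [N4 _ hN4]; near=> n.
have n1 : (0 < n)%N by near: n; exists 1%N.
have n0 : 0 < n%:R :> R by rewrite ltr0n.
rewrite lee_pdivrMl// /sigmat gt_eqF ?mulr_gt0//.
apply: ge_ereal_sup => _ [y' y'x <-].
pose y : pt R d := ptscale n%:R^-1 y'.
have y'E : y' = ptscale n%:R y.
  by apply/funext => i; rewrite /y /ptscale mulrA divff ?mul1r// gt_eqF.
have yx : ptle y x.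
  by move=> i; have := y'x i; rewrite y'E /ptscale ler_pM2l.
rewrite y'E; have [My|yM] := lerP M (normi y).
  apply: (@le_trans _ _ ((- ((C + 1) * n%:R * normi y `^ dexp R d))%:E +
    (C * n%:R * normi y `^ dexp R d)%:E)%E).
    apply: leeD.
      apply: far_s => //; first by near: n; exists N0.
      by apply: le_trans My; rewrite le_max lexx.
    apply: far_H => //; first by near: n; exists N1.
    exact: le_trans My.
  rewrite -EFinD -EFinM lee_fin; have := ler_wpM2l (ltW n0) (far_r y My).
  by move: (n%:R : R) (normi y `^ _) => n' b hb; lra.
have Ky : K (\row_i y i).
  move=> i; rewrite /= mxE in_itv/= yx andbT.
  have := le_lt_trans (normi_ge y i) yM; rewrite ltr_norml => /andP[+ _].
  exact: ltW.
have Nn : (N4 <= n)%N by near: n; exists N4.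
have ptE : pt_of (\row_i y i) = y by apply/funext => i; rewrite /pt_of mxE.
by have := hN4 n Nn _ Ky; rewrite /good ptE -EFinM (mulrC r).
Unshelve. all: by end_near. Qed.

End Deterministic.

(** * Intersection of the almost sure events and passage to the limit *)

Theorem theorem4p1 (R : realType) (d : nat) (hd : (2 <= d)%N)
  (c : R)
  (u0 : pt R d -> R)
  (hu0mon : nondecr u0) (hu0lip : loc_lipschitz u0) (hu0gr : u0_growth u0)
  (* probability space carrying the initial data *)
  (d1 : measure_display) (T1 : measurableType d1) (P1 : probability T1 R)
  (s0 : nat -> T1 -> pt R d -> \bar R)
  (hS : forall n, (0 < n)%N -> {ae P1, forall w, in_Sigma (s0 n w)})
  (h12 : forall y : pt R d, {ae P1, forall w,
     (fun n : nat => ((n%:R)^-1)%:E * s0 n w (ptscale n%:R y))%E @ \oo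
       --> (u0 y)%:E})
  (h13 : forall (b : pt R d) (C : R), 0 < C -> {ae P1, forall w,
     exists (M : R) (N : nat), 0 < M /\ (0 < N)%N /\
       forall (n : nat) (y : pt R d), (N <= n)%N -> ptle y b -> M <= normi y ->
         (s0 n w (ptscale n%:R y) <= (- (C * n%:R * normi y `^ dexp R d))%:E)%E})
  (* augmenting probability space carrying the Poisson process *)
  (d2 : measure_display) (T2 : measurableType d2) (P2 : probability T2 R)
  (pts : T2 -> set (spt R d))
  (hpp : poisson_pp P2 pts)
  (* c = c_{d+1}: the a.s. limit of the maximal chain length in (0,n1]^{d+1} / n *)
  (hc : {ae P2, forall w,
     (fun n : nat => ((n%:R)^-1)%:E * Hcount (pts w) (@ptzero R d)
                       (ptscale n%:R (@ptone R d)) n%:R)%E @ \oo --> c%:E}) :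
  forall (x : pt R d) (t : R), 0 <= t ->
    {ae (P1 \x P2)%E, forall w : T1 * T2,
       (fun n : nat => ((n%:R)^-1)%:E *
          sigmat (s0 n w.1) (pts w.2) (ptscale n%:R x) (n%:R * t))%E @ \oo
       --> ufun c u0 x t}.
Proof.
move=> x t t_ge0; have [->|tn0] := eqVneq t 0.
  have := ae_product (h12 x) (aeW P2 (fun w : T2 => I)).
  apply: filterS => w [cv _]; rewrite /ufun eqxx.
  by under eq_fun do rewrite mulr0 /sigmat eqxx.
have t0 : 0 < t by rewrite lt_neqAle eq_sym tn0.
have d0 : (0 < d)%N by rewrite (leq_trans _ hd).
pose f w n := ((n%:R)^-1%:E * sigmat (s0 n w.1) (pts w.2)
  (ptscale n%:R x) (n%:R * t))%E.
(* The base point is chosen from the level alone and not from the outcome, so each rational level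
   costs a single null set. *)
have lower (q : rat) : {ae (P1 \x P2)%E, forall w : T1 * T2,
    ((ratr q)%:E < ufun c u0 x t)%E ->
    \forall n \near \oo, ((ratr q)%:E <= f w n)%E}.
  have [qu|] := boolP ((ratr q)%:E < ufun c u0 x t)%E; last first.
    by move=> /negP h; apply: aeW => w qu; case: h.
  move: (qu); rewrite (ufunE c x t0) => /ereal_sup_gt[_ [y yx <-]].
  rewrite lte_fin => qy.
  (* The midpoint of [ratr q - u0 y] and [c * eff_size x t y], which leaves room in both the height
     and the chain bound. *)
  pose r2 := (ratr q - u0 y + c * eff_size x t y) / 2.
  have r2y : r2 < c * eff_size x t y by rewrite /r2; lra.
  have r1y : ratr q - r2 < u0 y by rewrite /r2; lra.
  have := ae_product (h12 y) (ae_Hcount_lower t0 hpp hc yx r2y).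
  apply: filterS => w [cvs hH] _.
  by have := @sigmat_lower R d u0 x t t0 (fun n => s0 n w.1) (pts w.2) y
    (ratr q - r2) r2 yx r1y cvs hH; rewrite subrK.
have [C C0 far] := ae_Hcount_far hpp x d0 t0.
have C10 : 0 < C + 1 by rewrite addr_gt0.
have mon : {ae P1, forall w, forall n, (0 < n)%N ->
    forall y z, ptle y z -> (s0 n w y <= s0 n w z)%E}.
  apply/ae_foralln => -[|n]; first exact: aeW.
  by apply: filterS (hS n.+1 isT) => w [_ [h _]] _.
have cvs : {ae P1, forall w, forall q : {ffun 'I_d -> rat},
    (fun n : nat => ((n%:R)^-1)%:E * s0 n w (ptscale n%:R (rat_pt R q)))%E @ \oo
      --> (u0 (rat_pt R q))%:E}.
  by apply: ae_forall_countable => q; exact: h12.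
(* Rational base points and accuracies [k.+1%:R^-1] leave only countably many almost sure events to
   intersect. *)
have near_H : {ae P2, forall w, forall (qk : {ffun 'I_d -> rat} * nat),
    ptlt (rat_pt R qk.1) x -> exists N : nat, forall n, (N <= n)%N ->
    (Hcount (pts w) (ptscale n%:R (rat_pt R qk.1)) (ptscale n%:R x) (n%:R * t) <=
     ((c * eff_size x t (rat_pt R qk.1) + qk.2.+1%:R^-1) * n%:R)%:E)%E}.
  apply: ae_forall_countable => -[q k] /=.
  have [qx|nqx] := pselect (ptlt (rat_pt R q) x); last by apply: aeW.
  have lt_r : c * eff_size x t (rat_pt R q) <
      c * eff_size x t (rat_pt R q) + k.+1%:R^-1.
    by rewrite ltrDl invr_gt0 ltr0n.
  by have := ae_Hcount_upper t0 hpp hc qx lt_r; apply: filterS => w h _.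
have up1 := ae_and mon (ae_and cvs (h13 x (C + 1) C10)).
have up2 := ae_and far near_H.
have := ae_and (ae_forall_countable lower) (ae_product up1 up2).
apply: filterS => w [low [[mw [cw fw]] [fw2 nw]]].
apply: cvge_rat_bounds => q qu; first exact: low.
exact: (@sigmat_upper R d c u0 d0 hu0lip x t t0 (fun n => s0 n w.1) (pts w.2)
  C (ratr q) C0 mw cw fw fw2 (fun q k => nw (q, k)) qu).
Qed.
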